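(* The following are equivalent: (i) the mean field game has a unique equilibrium $\rho$; (ii) the equation $u+F_t(r-cu)=1$, $u\in[0,1]$, has a unique solution for a dense set of $t\in\mathbb{R}_+$. In that case, any sequence $(\rho_n)_{n\ge1}$ of $n$-player equilibria Fatou converges in probability to $\rho$.
   Context: ''Increasing'' means non-decreasing. $(\Omega,\mathcal{G},P)$ is a probability space with a right-continuous filtration $\mathbb{G}=(\mathcal{G}_t)_{t\ge0}$; $r\in\mathbb{R}$ and $c>0$ are constants. A family of c.d.f.s $(F_t)_{t\ge0}$, each continuous in $y$, describes the signals of both games below: $F_t(y)=P\{Y^i_t\le y\}$. $n$-player game. $(Y^i)_{i\ge1}$ are $[0,\infty)$-valued processes which are right-continuous, increasing in $t$, $\mathbb{G}$-progressively measurable, and pairwise i.i.d. with common c.d.f. $F_t$ at time $t$; the $n$-player game has players $1,\dots,n$ with signals $Y^1,\dots,Y^n$. An $n$-player equilibrium is a $\mathbb{G}$-adapted process $\rho_n$ of the form $\rho_n(t)=\#\{j\le n:\tau^j\le t\}/n$, where $\tau^1,\dots,\tau^n$ are $\mathbb{G}$-stopping times with $\tau^i=\inf\{t\ge0:\alpha^i(t)\ge r\}$, $\alpha^i(t)=Y^i_t+c\rho_n^{-i}(t)$, $\rho_n^{-i}(t)=\#\{j\ne i:\tau^j\le t\}/n$. Mean field game. $(I,\mathcal{I},\lambda)$ is an atomless probability space and $(I\times\Omega,\Sigma,\mu)$ is a Fubini extension of $(I\times\Omega,\mathcal{I}\otimes\mathcal{G},\lambda\otimes P)$, i.e. a probability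 space extending the product such that for every $\mu$-integrable $f$ the sections $f(i,\cdot)$ and $f(\cdot,\omega)$ are integrable for a.e. $i$ and a.e. $\omega$, and both iterated integrals exist and equal $\int f\,d\mu$. For each $i\in I$, $Y^i$ is $[0,\infty)$-valued, right-continuous, increasing and $\mathbb{G}$-progressively measurable; for each $t$, $(i,\omega)\mapsto Y^i_t(\omega)$ is $\Sigma$-measurable and $(Y^i_t)_{i\in I}$ are $\lambda$-essentially pairwise i.i.d. with c.d.f. $F_t$ (for $\lambda$-a.e. $i$, $Y^i_t$ is independent of $Y^j_t$ for $\lambda$-a.e. $j$, with common c.d.f. $F_t$). Mean field equilibria are understood to be deterministic: a mean field equilibrium is a function $\rho:\mathbb{R}_+\to[0,1]$ such that $\rho(t)=\lambda\{i:\tau^i\le t\}$ ($P$-a.s.) for all $t\ge0$, where $\tau^i=\inf\{t:\alpha^i(t)\ge r\}$, $\alpha^i(t)=Y^i_t+c\rho(t)$, for $\lambda$-a.e. $i$. Standing assumptions: the times $\tau^i$ are a.s. finite. (They are the minimal optimizers of $\sup_\tau E[e^{r\tau}\mathbf{1}_{\{\theta^i>\tau\}\cup\{\theta^i=\infty\}}]$ over $\mathbb{G}$-stopping times, $\theta^i=\inf\{t:\int_0^t\alpha^i(s)ds=\mathcal{E}\}$ with $\mathcal{E}$ exponential and independent of $\mathbb{G}$; this value is assumed finite.) A sequence $(\rho_n)$ of $n$-player equilibria Fatou converges in probability to a mean field equilibrium $\rho$ if there is a dense set $D\subseteq\mathbb{R}_+$ such that $\rho_n(t)\to\rho(t)$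 in probability for all $t\in D$. *)

(* Defs.v *)
From HB Require Import structures.
From mathcomp Require Import all_boot all_order all_algebra.
From mathcomp Require Import all_classical all_reals all_analysis.

Set Implicit Arguments.
Unset Strict Implicit.
Unset Printing Implicit Defensive.

Import Order.TTheory GRing.Theory Num.Theory.
Import numFieldNormedType.Exports.

Local Open Scope classical_set_scope.
Local Open Scope ring_scope.

(* Time is R, but every definition only
   constrains the nonnegative times; a process is written X : R -> Omega -> R,
   and a random time takes its values in \bar R, so that it may be +oo. *)

Definition right_continuous_filtration (R : realType) (dO : measure_display)
    (Omega : measurableType dO) (G : R -> set (set Omega)) : Prop :=
  [/\ (forall t, 0 <= t -> sigma_algebra setT (G t)),
      (forall t, 0 <= t -> G t `<=` measurable),
      (forall s t, 0 <= s -> s <= t -> G s `<=` G t) &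
      (forall t, 0 <= t -> G t = \bigcap_(s in [set s | t < s]) G s)].

Definition adapted (R : realType) (dO : measure_display)
    (Omega : measurableType dO) (G : R -> set (set Omega))
    (X : R -> Omega -> R) : Prop :=
  forall t, 0 <= t ->
    measurable_fun [set: g_sigma_algebraType (G t)]
      (X t : g_sigma_algebraType (G t) -> R).

Definition progressively_measurable (R : realType) (dO : measure_display)
    (Omega : measurableType dO) (G : R -> set (set Omega))
    (X : R -> Omega -> R) : Prop :=
  forall t, 0 <= t ->
    measurable_fun (`[0, t]%classic `*` [set: g_sigma_algebraType (G t)])
      (fun p : (R * g_sigma_algebraType (G t))%type => X p.1 p.2).

Definition stopping_time (R : realType) (dO : measure_display)
    (Omega : measurableType dO) (G : R -> set (set Omega))
    (tau : Omega -> \bar R) : Prop :=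
  (forall w, (0 <= tau w)%E) /\
  (forall t, 0 <= t -> G t [set w | (tau w <= t%:E)%E]).

(* inf {t >= 0 : X_t >= r}, equal to +oo when X never reaches r *)
Definition hitting_time (R : realType) (Omega : Type)
    (r : R) (X : R -> Omega -> R) (w : Omega) : \bar R :=
  ereal_inf [set t%:E | t in [set t | 0 <= t /\ r <= X t w]].

Definition signal (R : realType) (dO : measure_display)
    (Omega : measurableType dO) (G : R -> set (set Omega))
    (Y : R -> Omega -> R) : Prop :=
  [/\ (forall t w, 0 <= t -> 0 <= Y t w),
      (forall w s t, 0 <= s -> s <= t -> Y s w <= Y t w),
      (forall w t, 0 <= t -> Y s w @[s --> t^'+] --> Y t w) &
      progressively_measurable G Y].

Definition has_cdf (R : realType) (dO : measure_display)
    (Omega : measurableType dO) (P : probability Omega R)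
    (X : Omega -> R) (Fx : R -> R) : Prop :=
  forall y, P [set w | X w <= y] = (Fx y)%:E.

Definition independent_rv (R : realType) (dO : measure_display)
    (Omega : measurableType dO) (P : probability Omega R)
    (X Z : Omega -> R) : Prop :=
  forall A B : set R, measurable A -> measurable B ->
    P (X @^-1` A `&` Z @^-1` B) = (P (X @^-1` A) * P (Z @^-1` B))%E.

Definition independent_of_filtration (R : realType) (dO : measure_display)
    (Omega : measurableType dO) (P : probability Omega R)
    (G : R -> set (set Omega)) (X : Omega -> R) : Prop :=
  forall t (A : set Omega) (B : set R), 0 <= t -> G t A -> measurable B ->
    P (A `&` X @^-1` B) = (P A * P (X @^-1` B))%E.

Definition atomless (R : realType) (dI : measure_display)
    (I : measurableType dI) (lambda : probability I R) : Prop :=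
  forall A, measurable A -> (0 < lambda A)%E ->
    exists B, [/\ measurable B, B `<=` A,
                  (0 < lambda B)%E & (lambda B < lambda A)%E].

(* No completeness is required of lambda and P: the partial integrals of f are
   only meaningful off a null set, so their integrability is stated for an
   integrable function that agrees with them almost everywhere. *)
Definition fubini_extension (R : realType) (dI dO : measure_display)
    (I : measurableType dI) (Omega : measurableType dO)
    (lambda : probability I R) (P : probability Omega R)
    (Sigma : set (set (I * Omega)))
    (mu : probability (g_sigma_algebraType Sigma) R) : Prop :=
  [/\ sigma_algebra setT Sigma,
      (forall A : set (I * Omega), measurable A ->
         Sigma A /\ mu A = (lambda \x P)%E A) &
      (forall f : I * Omega -> R,
         mu.-integrable [set: g_sigma_algebraType Sigma] (EFin \o f) ->
         [/\ (\forall i \ae lambda,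
                P.-integrable setT (fun w => (f (i, w))%:E)),
             (\forall w \ae P,
                lambda.-integrable setT (fun i => (f (i, w))%:E)),
             (exists g : I -> \bar R,
                [/\ lambda.-integrable setT g,
                    (\forall i \ae lambda, g i = \int[P]_w (f (i, w))%:E)%E &
                    (\int[lambda]_i g i = \int[mu]_z (f z)%:E)%E]) &
             (exists h : Omega -> \bar R,
                [/\ P.-integrable setT h,
                    (\forall w \ae P, h w = \int[lambda]_i (f (i, w))%:E)%E &
                    (\int[P]_w h w = \int[mu]_z (f z)%:E)%E])])].

Definition n_player_signals (R : realType) (dO : measure_display)
    (Omega : measurableType dO) (P : probability Omega R)
    (G : R -> set (set Omega)) (F : R -> R -> R)
    (Y : nat -> R -> Omega -> R) : Prop :=
  [/\ (forall i, signal G (Y i)),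
      (forall t i j, 0 <= t -> i <> j -> independent_rv P (Y i t) (Y j t)) &
      (forall t i, 0 <= t -> has_cdf P (Y i t) (F t))].

Definition mean_field_signals (R : realType) (dI dO : measure_display)
    (I : measurableType dI) (Omega : measurableType dO)
    (lambda : probability I R) (P : probability Omega R)
    (Sigma : set (set (I * Omega)))
    (G : R -> set (set Omega)) (F : R -> R -> R)
    (Y : I -> R -> Omega -> R) : Prop :=
  [/\ (forall i, signal G (Y i)),
      (forall t, 0 <= t ->
         measurable_fun [set: g_sigma_algebraType Sigma]
           (fun z : g_sigma_algebraType Sigma => Y z.1 t z.2)),
      (forall t, 0 <= t -> \forall i \ae lambda, \forall j \ae lambda,
         independent_rv P (Y i t) (Y j t)) &
      (forall t, 0 <= t -> \forall i \ae lambda, has_cdf P (Y i t) (F t))].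

Definition default_time (R : realType) (Omega : Type)
    (alpha : R -> Omega -> R) (E : Omega -> R) (w : Omega) : \bar R :=
  ereal_inf [set t%:E | t in [set t | 0 <= t /\
    (\int[lebesgue_measure]_(s in [set` `[0%R, t]]) (alpha s w)%:E = (E w)%:E)%E]].

(* E[e^(r tau) ; {theta > tau} or {theta = oo}] with theta the default time;
   the convention 0 * oo = 0 gives e^(r tau) = 1 for r = 0 and tau = +oo. *)
Definition expected_payoff (R : realType) (dO : measure_display)
    (Omega : measurableType dO) (P : probability Omega R)
    (r : R) (E : Omega -> R) (alpha : R -> Omega -> R)
    (tau : Omega -> \bar R) : \bar R :=
  (\int[P]_(w in [set w | tau w < default_time alpha E w \/
                          default_time alpha E w = +oo])
     expeR (r%:E * tau w))%E.

Definition optimal_value (R : realType) (dO : measure_display)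
    (Omega : measurableType dO) (P : probability Omega R)
    (G : R -> set (set Omega)) (r : R) (E : Omega -> R)
    (alpha : R -> Omega -> R) : \bar R :=
  ereal_sup [set expected_payoff P r E alpha tau | tau in stopping_time G].

Definition standing_assumption (R : realType) (dO : measure_display)
    (Omega : measurableType dO) (P : probability Omega R)
    (G : R -> set (set Omega)) (r : R) (E : Omega -> R)
    (alpha : R -> Omega -> R) : Prop :=
  (\forall w \ae P, hitting_time r alpha w < +oo)%E /\
  (optimal_value P G r E alpha < +oo)%E.

Definition stopped_fraction (R : realType) (Omega : Type) (n : nat)
    (tau : 'I_n -> Omega -> \bar R) (t : R) (w : Omega) : R :=
  #|[pred j : 'I_n | (tau j w <= t%:E)%E]|%:R / n%:R.

Definition stopped_fraction_others (R : realType) (Omega : Type) (n : nat)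
    (tau : 'I_n -> Omega -> \bar R) (i : 'I_n) (t : R) (w : Omega) : R :=
  #|[pred j : 'I_n | (j != i) && (tau j w <= t%:E)%E]|%:R / n%:R.

(* The n players are numbered from 0. *)
Definition n_player_intensity (R : realType) (Omega : Type) (c : R)
    (Y : nat -> R -> Omega -> R) (n : nat) (tau : 'I_n -> Omega -> \bar R)
    (i : 'I_n) (t : R) (w : Omega) : R :=
  Y i t w + c * stopped_fraction_others tau i t w.

(* The stopping times tau are an argument, not existentially quantified, so that
   their finiteness can be assumed separately. *)
Definition n_player_equilibrium (R : realType) (dO : measure_display)
    (Omega : measurableType dO) (G : R -> set (set Omega)) (r c : R)
    (Y : nat -> R -> Omega -> R) (n : nat) (tau : 'I_n -> Omega -> \bar R)
    (rho : R -> Omega -> R) : Prop :=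
  [/\ adapted G rho,
      (forall t w, 0 <= t -> rho t w = stopped_fraction tau t w),
      (forall i, stopping_time G (tau i)) &
      (forall i w, tau i w = hitting_time r (n_player_intensity c Y tau i) w)].

Definition mean_field_intensity (R : realType) (Omega I : Type) (c : R)
    (Y : I -> R -> Omega -> R) (rho : R -> R)
    (i : I) (t : R) (w : Omega) : R :=
  Y i t w + c * rho t.

(* A measure takes unspecified values on nonmeasurable sets, so the
   measurability of {i : tau^i <= t} has to be part of the condition. *)
Definition mean_field_equilibrium (R : realType) (dI dO : measure_display)
    (I : measurableType dI) (Omega : measurableType dO)
    (lambda : probability I R) (P : probability Omega R) (r c : R)
    (Y : I -> R -> Omega -> R) (rho : R -> R) : Prop :=
  (forall t, 0 <= t -> 0 <= rho t <= 1) /\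
  exists tau : I -> Omega -> \bar R,
    (\forall i \ae lambda, forall w,
       tau i w = hitting_time r (mean_field_intensity c Y rho i) w) /\
    (forall t, 0 <= t -> \forall w \ae P,
       measurable [set i | (tau i w <= t%:E)%E] /\
       lambda [set i | (tau i w <= t%:E)%E] = (rho t)%:E).

(* Only the restriction of rho to R_+ is unique. *)
Definition unique_mean_field_equilibrium (R : realType)
    (dI dO : measure_display)
    (I : measurableType dI) (Omega : measurableType dO)
    (lambda : probability I R) (P : probability Omega R) (r c : R)
    (Y : I -> R -> Omega -> R) (rho : R -> R) : Prop :=
  mean_field_equilibrium lambda P r c Y rho /\
  forall rho', mean_field_equilibrium lambda P r c Y rho' ->
    forall t, 0 <= t -> rho' t = rho t.

Definition dense_in_nonneg (R : realType) (D : set R) : Prop :=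
  D `<=` [set t | 0 <= t] /\ [set t | 0 <= t] `<=` closure D.

Definition fatou_cvg_in_probability (R : realType) (dO : measure_display)
    (Omega : measurableType dO) (P : probability Omega R)
    (rho_ : nat -> R -> Omega -> R) (rho : R -> R) : Prop :=
  exists D : set R, dense_in_nonneg D /\
    forall t, D t -> forall e, 0 < e ->
      P [set w | e <= `|rho_ n t w - rho t|] @[n --> \oo] --> 0%E.

(* Main.v *)
Require Import Defs.
From HB Require Import structures.
From mathcomp Require Import all_boot all_order all_algebra.
From mathcomp Require Import all_classical all_reals all_analysis.
From mathcomp Require Import measurable_realfun.
From mathcomp Require Import lra ring.
Import Order.TTheory GRing.Theory Num.Theory.
Import numFieldNormedType.Exports.
Set Implicit Arguments.
Unset Strict Implicit.
Unset Printing Implicit Defensive.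
Local Open Scope classical_set_scope.
Local Open Scope ring_scope.

(** Write [phi t u = u + F t (r - c * u)].  A mean field equilibrium is
    nondecreasing and right-continuous, hence so is the intensity of every
    player, and [tau^i <= t] holds exactly when [Y^i_t >= r - c * rho t].  The
    exact law of large numbers over the continuum of players
    ([exact_lln]) gives these players the mass [1 - F t (r - c * rho t)].
    Equilibria are therefore precisely the nondecreasing right-continuous
    selections [rho] of the solution sets of [phi t u = 1]
    ([mean_field_equilibrium_solution], [solution_mean_field_equilibrium]).

    The functions [phi t] are continuous in [u] and nonincreasing in [t], so the
    least and the greatest solution on the unit interval are nondecreasing in
    [t], and the right limit of a nondecreasing selection of solutions is again
    a selection of solutions ([right_limit_solution]).  If the equilibrium is
    unique, the right limits of the least and of the greatest solution agree; as
    a monotone function has only countably many jumps, the least solution equals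
    its right limit on a dense set, and there it is also the greatest one.
    Conversely, two equilibria that agree on a dense set agree everywhere by
    right-continuity.

    For finitely many players, monotonicity pins the stopped fraction [u] at time
    [t] between two values of the empirical tail function of the signals, which
    are taken at levels [r - c * u] and [r - c * u + c / n].  By the weak law of
    large numbers the tail at a fixed level is close to [1 - F t], so [u] avoids
    a neighbourhood of any [v] that is not a solution, with probability tending
    to one ([avoids_near_nonsolution]).  Compactness of the unit interval leaves
    only the solution of the equation as a limit when it is unique. *)

(** The properties of [F] inherited from a right-continuous nondecreasing signal
    whose law at each time has no atom; the equation is studied from them alone. *)
Definition cdf_family (R : realType) (F : R -> R -> R) : Prop :=
  [/\ (forall t, 0 <= t -> continuous (F t)),
      (forall t y, 0 <= t -> 0 <= F t y <= 1),
      (forall t y z, 0 <= t -> y <= z -> F t y <= F t z),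
      (forall s t y, 0 <= s -> s <= t -> F t y <= F s y) &
      (forall t y, 0 <= t -> F s y @[s --> t^'+] --> F t y)].

Definition solution (R : realType) (F : R -> R -> R) (r c t u : R) : Prop :=
  0 <= u <= 1 /\ u + F t (r - c * u) = 1.

Definition nondecreasing_in_time (R : realType) (rho : R -> R) : Prop :=
  forall s t, 0 <= s -> s <= t -> rho s <= rho t.

Definition right_continuous_in_time (R : realType) (rho : R -> R) : Prop :=
  forall t, 0 <= t -> rho s @[s --> t^'+] --> rho t.

(** For a nondecreasing [rho] this infimum is the limit from the right; as an
    infimum it needs no convergence proof to be defined. *)
Definition right_limit (R : realType) (rho : R -> R) (t : R) : R :=
  inf [set rho s | s in [set s | t < s]].

(** * Right limits of monotone functions *)

Section RightLimit.
Context (R : realType) (rho : R -> R).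
Hypothesis rho_nd : nondecreasing_in_time rho.

Lemma right_limit_has_inf t : 0 <= t ->
  has_inf [set rho s | s in [set s | t < s]].
Proof.
move=> t0; split; first by exists (rho (t + 1)), (t + 1) => //=; rewrite ltrDl.
by exists (rho t) => _ [s /= ts <-]; exact/rho_nd/ltW.
Qed.

Lemma right_limit_le s t : 0 <= s -> s < t -> right_limit rho s <= rho t.
Proof.
move=> s0 st; apply: ge_inf; last by exists t.
by case: (right_limit_has_inf s0).
Qed.

Lemma right_limit_ge t : 0 <= t -> rho t <= right_limit rho t.
Proof.
move=> t0; apply: lb_le_inf; first by case: (right_limit_has_inf t0).
by move=> _ [s /= ts <-]; exact/rho_nd/ltW.
Qed.

Lemma right_limit_adherent t e : 0 <= t -> 0 < e ->
  \forall s \near t^'+, rho s < right_limit rho t + e.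
Proof.
move=> t0 e0; have [_ [s /= ts <-] rs] := inf_adherent e0 (right_limit_has_inf t0).
near=> x; apply: le_lt_trans rs; apply: rho_nd.
  by rewrite (le_trans t0)// ltW.
by near: x; exact: nbhs_right_ltW.
Unshelve. all: end_near. Qed.

Lemma right_limit_nondecreasing : nondecreasing_in_time (right_limit rho).
Proof.
move=> s t s0; rewrite le_eqVlt => /predU1P[->//|st].
apply: (le_trans (right_limit_le s0 st)); apply: right_limit_ge.
by rewrite (le_trans s0)// ltW.
Qed.

Lemma right_limit_right_continuous : right_continuous_in_time (right_limit rho).
Proof.
move=> t t0; apply/cvgrPdist_lt => e e0.
have [s [/= ts rs]] : exists s, t < s /\ rho s < right_limit rho t + e.
  have [_ [s /= ts <-] rs] := inf_adherent e0 (right_limit_has_inf t0).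
  by exists s.
near=> x.
have tx : t < x by [].
have xs : x < s by near: x; exact: nbhs_right_lt.
have x0 : 0 <= x by rewrite (le_trans t0)// ltW.
have := right_limit_le x0 xs.
have := right_limit_nondecreasing t0 (ltW tx).
by move=> h1 h2; rewrite distrC ger0_norm; lra.
Unshelve. all: end_near. Qed.

(** A jump at [t] contains a rational number, and distinct jumps are disjoint:
    a monotone function jumps only countably often. *)
Lemma right_limit_eq_somewhere a b : 0 <= a -> a < b ->
  exists t, a < t < b /\ right_limit rho t = rho t.
Proof.
move=> a0 ab; apply: contrapT => nex.
have jump t : a < t < b -> rho t < right_limit rho t.
  move=> /andP[at_ tb]; rewrite lt_neqAle right_limit_ge ?(le_trans a0 (ltW at_))//.
  rewrite andbT; apply/eqP => e; apply: nex; exists t; split => //.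
  by rewrite at_ tb.
have cnt : countable (`]a, b[%classic : set R).
  pose J (q : rat) := [set t : R | a < t < b /\ rho t < ratr q < right_limit rho t].
  apply: (@sub_countable _ _ _ (\bigcup_(q in [set: rat]) J q)).
    apply: subset_card_le => t /=; rewrite in_itv/= => abt.
    have [q] := rat_in_itvoo (jump t abt); rewrite in_itv/= => qt.
    by exists q.
  apply: bigcup_countable => // q _.
  have sub1 s t : J q s -> J q t -> ~ s < t.
    move=> [/andP[as_ _] /andP[_ qs]] [/andP[at_ _] /andP[qt _]] st.
    have := @right_limit_le s t (le_trans a0 (ltW as_)) st.
    by have := lt_trans qt qs; rewrite ltNge => /negbTE ->.
  have [->|/set0P[s Js]] := eqVneq (J q) set0; first exact: countable0.
  apply: (@sub_countable _ _ _ [set s]); last exact: countable1.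
  apply: subset_card_le => t Jt /=.
  by have [/(sub1 _ _ Js Jt) []|/(sub1 _ _ Jt Js) []|->] := ltgtP s t.
have := countable_lebesgue_measure0 cnt.
rewrite lebesgue_measure_itv/= lte_fin ab => /eqP.
by rewrite -EFinB eqe subr_eq0 gt_eqF.
Qed.

End RightLimit.

(** * Solutions of the fixed point equation *)

Section Equation.
Context (R : realType) (F : R -> R -> R) (r c : R).
Hypothesis c_gt0 : 0 < c.
Hypothesis Ffam : cdf_family F.

Let phi t u := u + F t (r - c * u).

Let phi_continuous t : 0 <= t -> continuous (phi t).
Proof.
case: Ffam => Fc _ _ _ _ t0 u; apply: cvgD; first exact: cvg_id.
apply: (@continuous_comp _ _ _ (fun u => r - c * u) (F t)); last exact: Fc.
by apply: cvgB; [exact: cvg_cst|apply: cvgM; [exact: cvg_cst|exact: cvg_id]].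
Qed.

(** Intermediate value theorem.  Comparing [phi s] with [phi t] at a solution of
    one of the two equations, this moves solutions monotonically in time. *)
Lemma solution_between t a b : 0 <= t -> 0 <= a -> a <= b -> b <= 1 ->
  a + F t (r - c * a) <= 1 -> 1 <= b + F t (r - c * b) ->
  exists2 u, a <= u <= b & solution F r c t u.
Proof.
move=> t0 a0 ab b1 fa fb.
have [||u] := @IVT R (phi t) a b 1 ab.
- by apply: continuous_subspaceT; exact: phi_continuous.
- have fab := le_trans fa fb.
  by rewrite /phi min_l// max_r// fa fb.
rewrite in_itv/= => /andP[au ub] pu; exists u; first by rewrite au ub.
by split => //; rewrite (le_trans a0 au) (le_trans ub b1).
Qed.

Let phi0 t : 0 <= t -> 0 + F t (r - c * 0) <= 1.
Proof.
case: Ffam => _ F01 _ _ _ t0; rewrite add0r.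
by case/andP: (F01 t (r - c * 0) t0).
Qed.

Let phi1 t : 0 <= t -> 1 <= 1 + F t (r - c * 1).
Proof.
case: Ffam => _ F01 _ _ _ t0; rewrite lerDl.
by case/andP: (F01 t (r - c * 1) t0).
Qed.

Lemma solution_exists t : 0 <= t -> exists u, solution F r c t u.
Proof.
move=> t0.
have [u _ su] := solution_between t0 (lexx 0) ler01 (lexx 1) (phi0 t0) (phi1 t0).
by exists u.
Qed.

Lemma solution_closed t : 0 <= t -> closed [set u | solution F r c t u].
Proof.
move=> t0; rewrite (_ : mkset _ = `[0, 1]%classic `&` phi t @^-1` [set 1]).
  apply: closedI; first exact: itv_closed.
  by apply: preimage_closed; [move=> u _; exact: phi_continuous | exact: closed_eq].
by apply/seteqP; split=> u /=; rewrite in_itv.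
Qed.

Lemma solution_compact t : 0 <= t -> compact [set u | solution F r c t u].
Proof.
move=> t0; apply: (subclosed_compact (solution_closed t0) (@segment_compact R 0 1)).
by move=> u [u01 _] /=; rewrite in_itv.
Qed.

(** The least solution at time [t] satisfies [1 <= phi s u] for [s <= t], so
    there is a solution at time [s] below it. *)
Lemma least_solution : exists m : R -> R, nondecreasing_in_time m /\
  forall t, 0 <= t ->
    solution F r c t (m t) /\ forall u, solution F r c t u -> m t <= u.
Proof.
have /choice[m mP] t : exists u, 0 <= t -> solution F r c t u /\
    forall v, solution F r c t v -> u <= v.
  have [t0|] := leP 0 t; last by exists 0.
  have [] := @compact_EVT_min _ _ (@idfun R) _ _ (solution_compact t0).
  - exact: solution_exists.
  - by apply: continuous_subspaceT => x; exact: cvg_id.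
  - move=> u; rewrite inE => su um; exists u => _; split=> // v sv.
    by apply: um; rewrite inE.
exists m; split => // s t s0 st.
have t0 := le_trans s0 st.
have [[/andP[mt0 mt1] mte] _] := mP _ t0.
have [||u /andP[_ umt] /(mP _ s0).2] := solution_between s0 (lexx 0) mt0 mt1.
- exact: phi0.
- by case: Ffam => _ _ _ Fni _; rewrite -[leLHS]mte lerD2l Fni.
- by move=> msu; exact: le_trans umt.
Qed.

(** The greatest solution at time [s] satisfies [phi t u <= 1] for [s <= t], so
    there is a solution at time [t] above it. *)
Lemma greatest_solution : exists m : R -> R, nondecreasing_in_time m /\
  forall t, 0 <= t ->
    solution F r c t (m t) /\ forall u, solution F r c t u -> u <= m t.
Proof.
have /choice[m mP] t : exists u, 0 <= t -> solution F r c t u /\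
    forall v, solution F r c t v -> v <= u.
  have [t0|] := leP 0 t; last by exists 0.
  have [] := @compact_EVT_max _ _ (@idfun R) _ _ (solution_compact t0).
  - exact: solution_exists.
  - by apply: continuous_subspaceT => x; exact: cvg_id.
  - move=> u; rewrite inE => su um; exists u => _; split=> // v sv.
    by apply: um; rewrite inE.
exists m; split => // s t s0 st.
have t0 := le_trans s0 st.
have [[/andP[ms0 ms1] mse] _] := mP _ s0.
have [||u /andP[msu _] /(mP _ t0).2] := solution_between t0 ms0 ms1 (lexx 1).
- by case: Ffam => _ _ _ Fni _; rewrite -[leRHS]mse lerD2l Fni.
- exact: phi1.
- by move=> umt; exact: le_trans umt.
Qed.

(** The limit [L] is passed through the equation at times [s] decreasing to [t].
    Monotonicity of [F] in both arguments gives [1 <= phi t L].  For the other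
    inequality [F s] is bounded below at a level [d / 2] under [r - c * L], where
    right-continuity in time applies at a fixed level, so that no uniformity in
    the level is required. *)
Lemma right_limit_solution rho : nondecreasing_in_time rho ->
  (forall t, 0 <= t -> solution F r c t (rho t)) ->
  forall t, 0 <= t -> solution F r c t (right_limit rho t).
Proof.
move=> rho_nd rhoP t t0.
have rho01 s : 0 <= s -> 0 <= rho s <= 1 by move=> /rhoP[].
set L := right_limit rho t.
have L01 : 0 <= L <= 1.
  have rL := right_limit_ge rho_nd t0.
  have Lr : L <= rho (t + 1) by apply: right_limit_le => //; rewrite ltrDl.
  have /andP[r0 _] := rho01 t t0.
  have /andP[_ r1] := rho01 (t + 1) (addr_ge0 t0 ler01).
  by rewrite (le_trans r0 rL) (le_trans Lr r1).
case: Ffam => Fc _ Fnd Fni Frc.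
split => //; apply/eqP; rewrite eq_le; apply/andP; split; apply/ler_addgt0Pr => e e0.
- have e3 : 0 < e / 2 by rewrite divr_gt0.
  have /cvgrPdist_lt /(_ _ e3) [d /= d0 Fd] := Fc t t0 (r - c * L).
  have d2 : 0 < d / 2 by rewrite divr_gt0.
  have dc : 0 < d / 2 / c by rewrite divr_gt0.
  have {}Fd : `|F t (r - c * L) - F t (r - c * L - d / 2)| < e / 2.
    apply: Fd => /=; rewrite opprB addrC subrK gtr0_norm//.
    by rewrite ltr_pdivrMr// ltr_pMr// ltr1n.
  have /cvgrPdist_lt /(_ _ e3) Fs := Frc t (r - c * L - d / 2) t0.
  near t^'+ => s.
  have ts : t < s by [].
  have s0 : 0 <= s by rewrite (le_trans t0)// ltW.
  have [_ <-] := rhoP _ s0.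
  have Ls : L <= rho s by exact: right_limit_le.
  have sL : rho s < L + d / 2 / c.
    by near: s; exact: right_limit_adherent.
  have crs : c * rho s <= c * L + d / 2.
    move: sL => /ltW; rewrite -(ler_pM2l c_gt0) mulrDr (mulrC c (d / 2 / c)).
    by rewrite divfK// gt_eqF.
  have h1 : F s (r - c * L - d / 2) <= F s (r - c * rho s) by apply: Fnd => //; lra.
  have h2 : `|F t (r - c * L - d / 2) - F s (r - c * L - d / 2)| < e / 2.
    by near: s; exact: Fs.
  move: h2 Fd; rewrite !ltr_norml => /andP[_ h2] /andP[_ h3]; lra.
- have [_ [s /= ts <-] rs] := inf_adherent e0 (right_limit_has_inf rho_nd t0).
  have s0 : 0 <= s by rewrite (le_trans t0)// ltW.
  have [_ <-] := rhoP _ s0.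
  have Ls : L <= rho s by exact: right_limit_le.
  have h1 : F s (r - c * rho s) <= F s (r - c * L).
    by apply: Fnd => //; rewrite lerB// ler_pM2l.
  have h2 := Fni t s (r - c * L) t0 (ltW ts).
  by rewrite -/(right_limit rho t) -/L in rs; lra.
Unshelve. all: end_near. Qed.

End Equation.

(** * Signals and hitting times *)

(** Right-continuity makes the infimum attained, and monotonicity keeps the
    process above the level afterwards. *)
Lemma hitting_time_le (R : realType) (Omega : Type) (r : R)
    (X : R -> Omega -> R) (w : Omega) (t : R) :
  nondecreasing_in_time (X ^~ w) -> right_continuous_in_time (X ^~ w) ->
  0 <= t -> (hitting_time r X w <= t%:E)%E = (r <= X t w).
Proof.
move=> Xnd Xrc t0; apply/idP/idP => [|rX]; last first.
  by apply: ereal_inf_lbound; exists t.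
apply: contraTT; rewrite -!ltNge => Xr.
have [s ts sr] : exists2 s, t < s & X s w < r.
  near t^'+ => s; exists s => //.
  by near: s; exact: (cvgr_lt (X t w) (Xrc t t0)).
apply: (@lt_le_trans _ _ s%:E); first by rewrite lte_fin.
apply: le_ereal_inf_tmp => _ [v [v0 rv] <-]; rewrite lee_fin leNgt.
apply/negP => vs; have := Xnd v s v0 (ltW vs).
by move=> /(le_trans rv); rewrite leNgt sr.
Unshelve. all: end_near. Qed.

Section Signals.
Context (R : realType) (dO : measure_display) (Omega : measurableType dO).
Context (P : probability Omega R) (G : R -> set (set Omega)).
Hypothesis hG : right_continuous_filtration G.

Lemma adapted_measurable (X : R -> Omega -> R) t :
  adapted G X -> 0 <= t -> measurable_fun setT (X t).
Proof.
case: hG => sG Gm _ _ aX t0 _ B mB; rewrite setTI.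
apply: (Gm t t0); have := aX t t0 measurableT B mB; rewrite setTI.
by rewrite /measurable/= sigma_algebra_id//; exact: sG.
Qed.

(** The random variable [X t] is the section at [t] of the process restricted to
    times at most [t]. *)
Lemma signal_adapted (X : R -> Omega -> R) : signal G X -> adapted G X.
Proof.
case=> _ _ _ pX t t0.
pose sec (w : g_sigma_algebraType (G t)) : R * g_sigma_algebraType (G t) := (t, w).
apply: (@measurable_comp _ _ _ _ _ _
  (`[0, t]%classic `*` [set: g_sigma_algebraType (G t)])
  (fun p : (R * g_sigma_algebraType (G t))%type => X p.1 p.2) _ sec).
- by apply: measurableX => //; exact: measurable_itv.
- by move=> _ [w _ <-]; split => //=; rewrite in_itv/= t0 lexx.
- exact: pX.
- exact: measurable_pair1.
Qed.

Lemma signal_measurable (X : R -> Omega -> R) t :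
  signal G X -> 0 <= t -> measurable_fun setT (X t).
Proof. by move=> /signal_adapted; exact: adapted_measurable. Qed.

Lemma measurable_ge (X : Omega -> R) y :
  measurable_fun setT X -> measurable [set w | y <= X w].
Proof.
move=> mX; rewrite (_ : mkset _ = setT `&` X @^-1` `[y, +oo[%classic).
  by apply: mX => //; exact: measurable_itv.
by apply/seteqP; split => w /=; rewrite in_itv/= andbT // => -[].
Qed.

Lemma measurable_le (X : Omega -> R) y :
  measurable_fun setT X -> measurable [set w | X w <= y].
Proof.
move=> mX; rewrite (_ : mkset _ = setT `&` X @^-1` `]-oo, y]%classic).
  by apply: mX => //; exact: measurable_itv.
by apply/seteqP; split => w /=; rewrite in_itv/= // => -[].
Qed.

(** The event [X < y] is approximated from inside by [X <= z] with [z < y];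
    continuity of the distribution function excludes an atom at [y]. *)
Lemma probability_ge (X : Omega -> R) (Fx : R -> R) y :
  measurable_fun setT X -> has_cdf P X Fx -> continuous Fx ->
  P [set w | y <= X w] = (1 - Fx y)%:E.
Proof.
move=> mX cX Fc.
have mge := measurable_ge y mX.
have mle z := measurable_le z mX.
have Pfin : P [set w | y <= X w] \is a fin_num by exact: fin_num_measure.
rewrite -(fineK Pfin); congr EFin; apply/eqP; rewrite eq_le; apply/andP; split.
  apply/ler_addgt0Pr => e e0.
  have /cvgrPdist_lt /(_ _ e0) [d /= d0 Fd] := Fc y.
  have d2 : 0 < d / 2 by rewrite divr_gt0.
  have : `|Fx y - Fx (y - d / 2)| < e.
    apply: Fd => /=; rewrite opprB addrC subrK gtr0_norm//.
    by rewrite ltr_pdivrMr// ltr_pMr// ltr1n.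
  have : fine (P [set w | y <= X w]) <= 1 - Fx (y - d / 2).
    rewrite -lee_fin fineK// EFinB -cX -(probability_setC _ (mle _)).
    apply: le_measure; rewrite ?inE//; first exact: measurableC.
    by move=> w /= yX; apply/negP; rewrite -ltNge; lra.
  by rewrite ltr_norml => h /andP[_ h2]; lra.
rewrite lerBlDr -lee_fin EFinD fineK// -cX.
rewrite -(@probability_setT _ _ _ P).
rewrite (_ : [set: Omega] = [set w | y <= X w] `|` [set w | X w <= y]).
  by apply: measureU2.
apply/seteqP; split => w //= _; have [|/ltW] := leP y (X w); by [left|right].
Qed.

(** Right-continuity in time: the events [X s <= y] grow as [s] decreases to [t],
    and their union contains [X t < y], which has the same probability as
    [X t <= y] because the law of [X t] has no atom. *)
Lemma signal_cdf_family (X : R -> Omega -> R) (F : R -> R -> R) :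
  signal G X -> (forall t, 0 <= t -> has_cdf P (X t) (F t)) ->
  (forall t, 0 <= t -> continuous (F t)) -> cdf_family F.
Proof.
move=> sX cX Fc; case: (sX) => _ Xnd Xrc _.
have mX t : 0 <= t -> measurable_fun setT (X t) by exact: signal_measurable.
have mle t y : 0 <= t -> measurable [set w | X t w <= y].
  by move=> t0; exact: measurable_le (mX t t0).
have Fni s t y : 0 <= s -> s <= t -> F t y <= F s y.
  move=> s0 st; have t0 := le_trans s0 st.
  rewrite -lee_fin -(cX _ t0) -(cX _ s0).
  apply: le_measure; rewrite ?inE; [exact: mle|exact: mle|].
  by move=> w /=; apply: le_trans; exact: Xnd.
split => //.
- move=> t y t0; rewrite -!lee_fin -(cX _ t0) measure_ge0/=.
  exact: probability_le1 (mle _ _ t0).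
- move=> t y z t0 yz; rewrite -lee_fin -!(cX _ t0).
  apply: le_measure; rewrite ?inE; [exact: mle|exact: mle|].
  by move=> w /= /le_trans; exact.
- move=> t y t0.
  pose s_ n := t + n.+1%:R^-1.
  have ts n : t < s_ n by rewrite ltrDl invr_gt0.
  have s0 n : 0 <= s_ n by rewrite (le_trans t0)// ltW.
  pose B n := [set w | X (s_ n) w <= y].
  have mB n : measurable (B n) by exact: mle.
  have mUB : measurable (\bigcup_n B n) by exact: bigcup_measurable.
  have ndB : nondecreasing_seq B.
    move=> n m nm; apply/subsetPset => w /=; apply: le_trans; apply: Xnd => //.
    by rewrite lerD2l lef_pV2 ?posrE// ler_nat.
  have BF : F t y <= fine (P (\bigcup_n B n)).
    have := probability_ge y (mX t t0) (cX t t0) (Fc t t0) => Pge.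
    rewrite -lee_fin fineK ?fin_num_measure//.
    rewrite (_ : F t y = 1 - (1 - F t y)); last by rewrite subKr.
    rewrite EFinB -Pge -probability_setC; last exact: measurable_ge (mX t t0).
    apply: le_measure; rewrite ?inE//.
      by apply: measurableC; exact: measurable_ge (mX t t0).
    move=> w /= /negP; rewrite -ltNge => Xy.
    have /(cvgr_lt _)/(_ _ Xy) [d /= d0 Xd] := Xrc w t t0.
    near \oo => n; exists n => //=; apply/ltW/Xd => //=.
    rewrite /s_ opprD addrA subrr sub0r normrN gtr0_norm ?invr_gt0//.
    by near: n; exact: near_infty_natSinv_lt (PosNum d0).
  have cvB : fine \o (P \o B) @ \oo --> fine (P (\bigcup_n B n)).
    apply: fine_cvg; rewrite fineK ?fin_num_measure//.
    exact: nondecreasing_cvg_mu mB mUB ndB.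
  apply/cvgrPdist_lt => e e0.
  have [n Fn] : exists n, F t y - e < F (s_ n) y.
    near \oo => n; exists n.
    have -> : F (s_ n) y = fine (P (B n)) by rewrite /B cX.
    near: n; apply: (cvgr_gt _ cvB); lra.
  near=> s.
  have st : t < s by [].
  have ssn : s <= s_ n by near: s; exact: nbhs_right_ltW.
  have ss0 : 0 <= s by rewrite (le_trans t0)// ltW.
  have h1 := Fni t s y t0 (ltW st).
  have h2 := Fni s (s_ n) y ss0 ssn.
  by rewrite ger0_norm; lra.
Unshelve. all: end_near. Qed.

End Signals.

(** * The exact law of large numbers *)

Section UnitInterval.
Context (d : measure_display) (T : measurableType d) (R : realType).
Context (Q : probability T R).

Lemma unit_interval_integrable (f : T -> R) :
  measurable_fun setT f -> (forall x, 0 <= f x <= 1) ->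
  Q.-integrable setT (EFin \o f).
Proof.
move=> mf f01; apply: measurable_bounded_integrable => //.
  by rewrite (le_lt_trans (probability_le1 _ measurableT))// ltry.
exists 1; split => // M M1 x _ /=; have /andP[f0 f1] := f01 x.
by rewrite ger0_norm// (le_trans f1)// ltW.
Qed.

Lemma indic_preimage (U : Type) (g : T -> U) (A : set U) :
  (fun x => \1_A (g x) : R) = \1_(g @^-1` A).
Proof.
by apply/funext => x; rewrite !indicE.
Qed.

Lemma integral_indic_preimage (U : Type) (g : T -> U) (A : set U) :
  measurable (g @^-1` A) ->
  (\int[Q]_x (\1_A (g x) : R)%:E = Q (g @^-1` A))%E.
Proof.
move=> mA; have := integral_indic Q measurableT mA; rewrite setIT => <-.
by apply: eq_integral => x _; rewrite -indic_preimage.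
Qed.

(** Deterministic conclusions are drawn from almost sure ones by evaluating at one
    good sample point. *)
Lemma ae_exists (A : T -> Prop) : (\forall x \ae Q, A x) -> exists x, A x.
Proof.
move=> [N [mN N0 AN]]; apply: contrapT => nA.
suff NT : N = setT by move: N0; rewrite NT probability_setT => /eqP; rewrite onee_eq0.
by apply/seteqP; split => // x _; apply: AN => Ax; apply: nA; exists x.
Qed.

(** The square is expanded as [(f - a)^2 + 2 a f = f^2 + a^2], with nonnegative
    terms on both sides, so that additivity holds without integrability
    conditions. *)
Lemma integral_sqr_deviation (f : T -> R) (a b : R) :
  measurable_fun setT f -> (forall x, 0 <= f x) -> 0 <= a ->
  (\int[Q]_x (f x)%:E = a%:E)%E -> (\int[Q]_x (f x * f x)%:E = b%:E)%E ->
  (\int[Q]_x ((f x - a) * (f x - a))%:E = (b - a * a)%:E)%E.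
Proof.
move=> mf f0 a0 fa ffb.
have mff : measurable_fun setT (fun x => f x * f x) by exact: measurable_funM.
have mD : measurable_fun setT (fun x => (f x - a) * (f x - a)).
  by apply: measurable_funM; apply: measurable_funB => //; exact: measurable_cst.
have maf : measurable_fun setT (fun x => (a + a) * f x).
  by apply: measurable_funM => //; exact: measurable_cst.
have : (\int[Q]_x ((f x - a) * (f x - a))%:E + \int[Q]_x ((a + a) * f x)%:E =
        \int[Q]_x (f x * f x)%:E + \int[Q]_x (a * a)%:E)%E.
  rewrite -ge0_integralD//; first last.
  - exact/measurable_EFinP.
  - by move=> x _; rewrite lee_fin mulr_ge0 ?addr_ge0.
  - exact/measurable_EFinP.
  - by move=> x _; rewrite lee_fin -expr2 sqr_ge0.
  rewrite -ge0_integralD//; first last.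
  - by move=> x _; rewrite lee_fin -expr2 sqr_ge0.
  - exact/measurable_EFinP.
  - by move=> x _; rewrite lee_fin -expr2 sqr_ge0.
  by apply: eq_integral => x _; rewrite -!EFinD; congr EFin; ring.
have -> : (\int[Q]_x ((a + a) * f x)%:E = ((a + a) * a)%:E)%E.
  under eq_integral do rewrite EFinM.
  rewrite ge0_integralZl_EFin ?fa ?addr_ge0//.
  - by move=> x _; rewrite lee_fin.
  - exact/measurable_EFinP.
rewrite ffb (integral_cst Q measurableT (a * a)%:E).
rewrite [X in (_ * X)%E](probability_setT Q) mule1 -EFinD mulrDl.
case: (\int[Q]_x _)%E => [z| |]//; rewrite -EFinD => -[zE].
by congr EFin; lra.
Qed.

Lemma variance0_ae_cst (f : T -> R) (p : R) :
  measurable_fun setT f -> (forall x, 0 <= f x) -> 0 <= p ->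
  (\int[Q]_x (f x)%:E = p%:E)%E ->
  (\int[Q]_x (f x * f x)%:E = (p * p)%:E)%E ->
  \forall x \ae Q, f x = p.
Proof.
move=> mf f0 p0 fp ffp.
have D0 : (\int[Q]_x ((f x - p) * (f x - p))%:E = 0)%E.
  by rewrite (integral_sqr_deviation mf f0 p0 fp ffp) subrr.
have abs0 : (\int[Q]_x `|((f x - p) * (f x - p))%:E| = 0)%E.
  rewrite -D0; apply: eq_integral => x _.
  by rewrite abse_EFin ger0_norm// -expr2 sqr_ge0.
have mDE : measurable_fun setT (fun x => ((f x - p) * (f x - p))%:E).
  apply/measurable_EFinP.
  by apply: measurable_funM; apply: measurable_funB => //; exact: measurable_cst.
have [/(_ abs0) + _] := ae_eq_integral_abs Q measurableT mDE.
apply: filterS => x /(_ Logic.I) /= [] /eqP.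
by rewrite mulf_eq0 orbb subr_eq0 => /eqP.
Qed.

End UnitInterval.

Section ExactLLN.
Context (R : realType) (dI dO : measure_display).
Context (I : measurableType dI) (Omega : measurableType dO).
Context (lambda : probability I R) (P : probability Omega R).
Context (Sigma : set (set (I * Omega))).
Context (mu : probability (g_sigma_algebraType Sigma) R).
Hypothesis hmu : fubini_extension lambda P mu.

Let Sigma_measurable (A : set (I * Omega)) :
  Sigma A <-> measurable (A : set (g_sigma_algebraType Sigma)).
Proof. by case: hmu => sS _ _; rewrite /measurable/= sigma_algebra_id. Qed.

Let product_measurable (f : I * Omega -> R) : measurable_fun setT f ->
  measurable_fun [set: g_sigma_algebraType Sigma] (f : g_sigma_algebraType Sigma -> R).
Proof.
case: hmu => _ mS _ mf _ B mB; apply/Sigma_measurable.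
by apply: (mS _ _).1; exact: mf.
Qed.

(** Both iterated integrals equal the integral on the Fubini extension.  The
    partial integral over [I] is replaced by a measurable version [K], since the
    definition provides such versions only almost everywhere. *)
Lemma fubini_exchange (f : I * Omega -> R) (a : R) (K : Omega -> R) :
  measurable_fun [set: g_sigma_algebraType Sigma] (f : g_sigma_algebraType Sigma -> R) ->
  (forall z, 0 <= f z <= 1) -> measurable_fun setT K ->
  (\forall i \ae lambda, (\int[P]_w (f (i, w))%:E = a%:E)%E) ->
  (\forall w \ae P, (\int[lambda]_i (f (i, w))%:E = (K w)%:E)%E) ->
  (\int[P]_w (K w)%:E = a%:E)%E.
Proof.
move=> mf f01 mK fa fK; case: hmu => _ _ /(_ f (unit_interval_integrable mu mf f01)).
move=> [_ _ [g [gint gE gmu]] [h [hint hE hmu']]].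
have <- : (\int[P]_w h w = \int[P]_w (K w)%:E)%E.
  apply: ae_eq_integral => //.
  - by case/integrableP: hint.
  - exact/measurable_EFinP.
  - by apply: filterS2 hE fK => w -> ->.
have <- : (\int[lambda]_i g i = a%:E)%E.
  have -> : (\int[lambda]_i g i = \int[lambda]_i (cst a%:E i))%E.
    apply: ae_eq_integral => //.
    - by case/integrableP: gint.
    - by apply: filterS2 gE fa => w -> ->.
  by rewrite integral_cst// [X in (_ * X)%E](probability_setT lambda) mule1.
by rewrite gmu hmu'.
Qed.

(** The measure of the section at [w] is measurable in [w] only up to a null set;
    truncation to the unit interval makes the version [H] bounded, so that
    products with it remain integrable on the extension. *)
Lemma section_measure (A : set (I * Omega)) : Sigma A ->
  (\forall w \ae P, measurable [set i | A (i, w)]) /\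
  exists H : Omega -> R, [/\ measurable_fun setT H, (forall w, 0 <= H w <= 1) &
    \forall w \ae P, lambda [set i | A (i, w)] = (H w)%:E].
Proof.
move=> SA.
have mA : measurable_fun [set: g_sigma_algebraType Sigma]
    (\1_A : g_sigma_algebraType Sigma -> R).
  by apply: measurable_indic; apply/Sigma_measurable.
have A01 z : 0 <= (\1_A z : R) <= 1.
  by rewrite indicE; case: (z \in A); rewrite ?lexx ?ler01.
case: hmu => _ _ /(_ (\1_A) (unit_interval_integrable mu mA A01)).
move=> [_ Aint _ [h [hint hE _]]].
have secm : \forall w \ae P, measurable [set i | A (i, w)].
  apply: filterS Aint => w /integrableP[/measurable_EFinP + _].
  by rewrite (indic_preimage _ (pair^~ w)) => /measurable_indicP.
split => //.
exists (fun w => Num.min 1 (Num.max 0 (fine (h w)))); split.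
- apply: measurable_minr; first exact: measurable_cst.
  apply: measurable_maxr; first exact: measurable_cst.
  have mh : measurable_fun setT h by case/integrableP: hint.
  exact: measurableT_comp.
- by move=> w; rewrite le_min ler01 le_max lexx/= ge_min lexx.
- apply: filterS2 secm hE => w mw ->.
  have -> : (\int[lambda]_i (\1_A (i, w))%:E = lambda [set i | A (i, w)])%E.
    exact: (@integral_indic_preimage _ _ _ lambda _ (pair^~ w)).
  have := measure_ge0 lambda [set i | A (i, w)].
  have := probability_le1 lambda mw.
  have /fineK <- := fin_num_measure lambda _ mw.
  by rewrite lee_fin => l1 l0; rewrite max_r ?min_r //= fine_ge0.
Qed.

(** Let [H w] be the mass of the section of [A] at [w].  Exchanging the order of
    integration once gives mean [p] for [H].  For the second moment, the mean of
    [H^2] is the average over [i] of the integral of [H] on the [i]-th section,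
    which is itself the average over [j] of [P (A_i `&` A_j)]; essential pairwise
    independence makes all of these equal to [p * p].  So [H] has variance
    zero. *)
Theorem exact_lln (A : set (I * Omega)) (p : R) :
  Sigma A -> (forall i, measurable [set w | A (i, w)]) ->
  (\forall i \ae lambda, P [set w | A (i, w)] = p%:E) ->
  (\forall i \ae lambda, \forall j \ae lambda,
    P ([set w | A (i, w)] `&` [set w | A (j, w)]) = (p * p)%:E) ->
  \forall w \ae P, measurable [set i | A (i, w)] /\
    lambda [set i | A (i, w)] = p%:E.
Proof.
move=> SA mAi Ap App.
have [secm [H [mH H01 HE]]] := section_measure SA.
have p0 : 0 <= p.
  by have [i Pi] := ae_exists Ap; rewrite -lee_fin -Pi.
pose one (B : set (I * Omega)) : I * Omega -> R := \1_B.
have one01 B z : 0 <= one B z <= 1.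
  by rewrite /one indicE; case: (z \in B); rewrite ?lexx ?ler01.
have mone B : Sigma B -> measurable_fun [set: g_sigma_algebraType Sigma]
    (one B : g_sigma_algebraType Sigma -> R).
  by move=> SB; apply: measurable_indic; apply/Sigma_measurable.
have oneM B C z : one B z * one C z = one (B `&` C) z.
  by rewrite /one indicI.
have int1i i B : measurable [set w | B (i, w)] ->
    (\int[P]_w (one B (i, w))%:E = P [set w | B (i, w)])%E.
  exact: (@integral_indic_preimage _ _ _ P _ (pair i)).
have int1w B w : measurable [set i | B (i, w)] ->
    (\int[lambda]_i (one B (i, w))%:E = lambda [set i | B (i, w)])%E.
  exact: (@integral_indic_preimage _ _ _ lambda _ (pair^~ w)).
have EH : (\int[P]_w (H w)%:E = p%:E)%E.
  apply: (@fubini_exchange (one A)) => //; first exact: mone.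
  - by apply: filterS Ap => i <-; exact: int1i.
  - by apply: filterS2 secm HE => w mw <-; exact: int1w.
have intK (K : Omega -> R) : \forall w \ae P,
    (\int[lambda]_i (one A (i, w) * K w)%:E = (H w * K w)%:E)%E.
  apply: filterS2 secm HE => w mw HEw.
  under eq_integral do rewrite EFinM.
  rewrite integralZr//; first by rewrite int1w// HEw EFinM.
  apply: unit_interval_integrable => //.
  by rewrite /one (indic_preimage _ (pair^~ w)); exact: measurable_indic.
(* The integral of [H] on the [i]-th section, from the exchange on [A `&` (I * A_i)]. *)
have EAH : \forall i \ae lambda, (\int[P]_w (one A (i, w) * H w)%:E = (p * p)%:E)%E.
  apply: filterS App => i Appi.
  pose B := [set z : I * Omega | A (i, z.2)].
  have mB : measurable B.
    rewrite (_ : B = setT `*` [set w | A (i, w)]).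
      by apply: measurableX => //; exact: mAi.
    by apply/seteqP; split => -[j w]//= -[].
  have SB : Sigma B by case: hmu => _ /(_ _ mB)[].
  have SAB : Sigma (A `&` B).
    by apply/Sigma_measurable; apply: measurableI; apply/Sigma_measurable.
  have mAi' : measurable_fun setT (fun w => one A (i, w)).
    by rewrite /one (indic_preimage _ (pair i)); apply: measurable_indic; exact: mAi.
  apply: (@fubini_exchange (one (A `&` B))) => //; first exact: mone.
  - exact: measurable_funM.
  - apply: filterS Appi => j <-; rewrite int1i; last by apply: measurableI; exact: mAi.
    by congr (P _); apply/seteqP; split => w [].
  - apply: filterS (intK (fun w => one A (i, w))) => w.
    rewrite mulrC => <-; apply: eq_integral => j _.
    by rewrite -oneM.
have EHH : (\int[P]_w (H w * H w)%:E = (p * p)%:E)%E.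
  apply: (@fubini_exchange (fun z => one A z * H z.2)) => //.
  - apply: measurable_funM; first exact: mone.
    by apply: product_measurable; apply: measurableT_comp.
  - move=> z; have /andP[a0 a1] := one01 A z; have /andP[h0 h1] := H01 z.2.
    by rewrite mulr_ge0//= mulr_ile1.
  - exact: measurable_funM.
  - exact: (intK H).
have H0 w : 0 <= H w by case/andP: (H01 w).
have Hp := variance0_ae_cst mH H0 p0 EH EHH.
by apply: filterS3 secm HE Hp => w mw -> ->.
Qed.

End ExactLLN.

(** * Mean field equilibria *)

Lemma measure_ae_eq (d : measure_display) (T : measurableType d) (R : realType)
    (Q : {measure set T -> \bar R}) (A B : set T) :
  measurable A -> measurable B -> (\forall x \ae Q, A x <-> B x) -> Q A = Q B.
Proof.
suff le C D : measurable C -> measurable D ->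
    (\forall x \ae Q, C x -> D x) -> (Q C <= Q D)%E.
  move=> mA mB AB; apply/eqP; rewrite eq_le !le//.
  - by apply: filterS AB => x [].
  - by apply: filterS AB => x [].
move=> mC mD [N [mN N0 CDN]].
apply: (@le_trans _ _ (Q (D `|` N))).
  apply: le_measure; rewrite ?inE//; first exact: measurableU.
  move=> x Cx; have [Dx|nDx] := pselect (D x); [by left|right].
  by apply: CDN => /(_ Cx).
by apply: le_trans (measureU2 _ mD mN) _; rewrite [X in (_ + X)%E]N0 adde0.
Qed.

Lemma nondecreasing_intensity (R : realType) (c : R) (y rho : R -> R) :
  0 <= c -> nondecreasing_in_time y -> nondecreasing_in_time rho ->
  nondecreasing_in_time (fun t => y t + c * rho t).
Proof.
by move=> c0 ynd rnd s t s0 st; rewrite lerD ?ynd// ler_wpM2l// rnd.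
Qed.

Lemma right_continuous_intensity (R : realType) (c : R) (y rho : R -> R) :
  right_continuous_in_time y -> right_continuous_in_time rho ->
  right_continuous_in_time (fun t => y t + c * rho t).
Proof.
move=> yrc rrc t t0; apply: cvgD; first exact: yrc.
by apply: cvgM; [exact: cvg_cst|exact: rrc].
Qed.

Section MeanField.
Context (R : realType) (dI dO : measure_display).
Context (I : measurableType dI) (Omega : measurableType dO).
Context (lambda : probability I R) (P : probability Omega R).
Context (Sigma : set (set (I * Omega))).
Context (mu : probability (g_sigma_algebraType Sigma) R).
Context (G : R -> set (set Omega)) (r c : R) (F : R -> R -> R).
Context (Y : I -> R -> Omega -> R).
Hypothesis hG : right_continuous_filtration G.
Hypothesis hc : 0 < c.
Hypothesis hF : forall t, 0 <= t -> continuous (F t).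
Hypothesis hmu : fubini_extension lambda P mu.
Hypothesis hY : mean_field_signals lambda P Sigma G F Y.

Lemma signal_level_measure t y : 0 <= t ->
  \forall w \ae P, measurable [set i | y <= Y i t w] /\
    lambda [set i | y <= Y i t w] = (1 - F t y)%:E.
Proof.
case: hY => sY mY indY cY t0.
have mYi i : measurable_fun setT (Y i t) by exact: signal_measurable (sY i) t0.
have Pge : \forall i \ae lambda, P [set w | y <= Y i t w] = (1 - F t y)%:E.
  apply: filterS (cY t t0) => i ci.
  exact: probability_ge (mYi i) ci (hF t0).
apply: (@exact_lln _ _ _ _ _ _ _ _ _ hmu [set z | y <= Y z.1 t z.2]) => //=.
- have := measurable_ge y (mY t t0).
  by case: hmu => sS _ _; rewrite /measurable/= sigma_algebra_id.
- by move=> i; exact: measurable_ge.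
- apply: filterS2 (Pge) (indY t t0) => i Pi indi.
  apply: filterS2 Pge indi => j Pj indij.
  have := indij `[y, +oo[%classic `[y, +oo[%classic (measurable_itv _) (measurable_itv _).
  have pre k : Y k t @^-1` `[y, +oo[%classic = [set w | y <= Y k t w].
    by apply/seteqP; split => w /=; rewrite in_itv/= andbT.
  by rewrite !pre Pi Pj -EFinM.
Qed.

Lemma mean_field_hitting_time_le (rho : R -> R) i w t :
  nondecreasing_in_time rho -> right_continuous_in_time rho -> 0 <= t ->
  (hitting_time r (mean_field_intensity c Y rho i) w <= t%:E)%E =
  (r - c * rho t <= Y i t w).
Proof.
case: hY => sY _ _ _ rnd rrc t0; have [_ Ynd Yrc _] := sY i.
rewrite hitting_time_le//; first by rewrite lerBlDr.
- exact: nondecreasing_intensity (ltW hc) (Ynd w) rnd.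
- exact: right_continuous_intensity (Yrc w) rrc.
Qed.

Lemma solution_mean_field_equilibrium (rho : R -> R) :
  nondecreasing_in_time rho -> right_continuous_in_time rho ->
  (forall t, 0 <= t -> solution F r c t (rho t)) ->
  mean_field_equilibrium lambda P r c Y rho.
Proof.
move=> rnd rrc rsol; split; first by move=> t /rsol[].
exists (fun i => hitting_time r (mean_field_intensity c Y rho i)); split.
  exact: aeW.
move=> t t0; apply: filterS (signal_level_measure (r - c * rho t) t0) => w.
rewrite (_ : [set i | (r - c * rho t <= Y i t w)] =
  [set i | (hitting_time r (mean_field_intensity c Y rho i) w <= t%:E)%E]).
  by move=> [m ->]; split => //; have [_ <-] := rsol t t0; rewrite addrK.
by apply/seteqP; split => i /=; rewrite mean_field_hitting_time_le.
Qed.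

(** Monotonicity and right-continuity are inherited from the sets
    [tau^i <= t] at a single sample point that is good at countably many times
    simultaneously; only after that are the hitting times explicit enough for the
    law of large numbers at the level [r - c * rho t]. *)
Lemma mean_field_equilibrium_solution (rho : R -> R) :
  mean_field_equilibrium lambda P r c Y rho ->
  [/\ nondecreasing_in_time rho, right_continuous_in_time rho &
      forall t, 0 <= t -> solution F r c t (rho t)].
Proof.
move=> [rho01 [tau [tauE rhoE]]].
have rnd : nondecreasing_in_time rho.
  move=> s t s0 st; have t0 := le_trans s0 st.
  have [w [[ms es] [mt et]]] := ae_exists (filterI (rhoE s s0) (rhoE t t0)).
  rewrite -lee_fin -es -et; apply: le_measure; rewrite ?inE//.
  by move=> i /= /le_trans; apply; rewrite lee_fin.
have rrc : right_continuous_in_time rho.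
  move=> t t0; pose s_ n := t + n.+1%:R^-1.
  have ts n : t < s_ n by rewrite ltrDl invr_gt0.
  have s0 n : 0 <= s_ n by rewrite (le_trans t0)// ltW.
  have [w [[mt et] ws]] := ae_exists (filterI (rhoE t t0)
    (ae_foralln (fun n => rhoE (s_ n) (s0 n)))).
  pose B n := [set i | (tau i w <= (s_ n)%:E)%E].
  have mB n : measurable (B n) by case: (ws n).
  have capB : \bigcap_n B n = [set i | (tau i w <= t%:E)%E].
    apply/seteqP; split => i; last first.
      by move=> /= it n _; rewrite /B/= (le_trans it)// lee_fin ltW.
    move=> Bi /=; apply/lee_addgt0Pr => e e0.
    near \oo => n; apply: (le_trans (Bi n Logic.I)).
    rewrite -EFinD lee_fin lerD2l ltW//.
    by near: n; exact: near_infty_natSinv_lt (PosNum e0).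
  have niB : nonincreasing_seq B.
    move=> n m nm; apply/subsetPset => i /=; rewrite /B/= => /le_trans; apply.
    by rewrite lee_fin lerD2l lef_pV2 ?posrE// ler_nat.
  have cvB : fine \o (lambda \o B) @ \oo --> rho t.
    apply: fine_cvg; rewrite -et -capB; apply: nonincreasing_cvg_mu => //.
      by rewrite (le_lt_trans (probability_le1 _ (mB 0)))// ltry.
    by rewrite capB.
  apply/cvgrPdist_lt => e e0.
  have [n Fn] : exists n, rho (s_ n) < rho t + e.
    near \oo => n; exists n.
    have -> : rho (s_ n) = fine (lambda (B n)) by rewrite /B (ws n).2.
    near: n; apply: (cvgr_lt _ cvB); lra.
  near=> s.
  have st : t < s by [].
  have ssn : s <= s_ n by near: s; exact: nbhs_right_ltW.
  have ss0 : 0 <= s by rewrite (le_trans t0)// ltW.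
  have h1 := rnd t s t0 (ltW st).
  have h2 := rnd s (s_ n) ss0 ssn.
  by rewrite distrC ger0_norm; lra.
split => // t t0; split; first exact: rho01.
have [w [[mt et] [ml el]]] := ae_exists (filterI (rhoE t t0)
  (signal_level_measure (r - c * rho t) t0)).
have : (rho t)%:E = (1 - F t (r - c * rho t))%:E.
  rewrite -et -el; apply: measure_ae_eq => //.
  apply: filterS tauE => i /(_ w) tauiw /=.
  by rewrite tauiw mean_field_hitting_time_le.
by move=> -[rE]; rewrite {1}rE subrK.
Unshelve. all: end_near. Qed.

End MeanField.

Lemma right_continuous_eq (R : realType) (D : set R) (f g : R -> R) :
  dense_in_nonneg D -> right_continuous_in_time f -> right_continuous_in_time g ->
  (forall t, D t -> f t = g t) -> forall t, 0 <= t -> f t = g t.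
Proof.
move=> [D0 Dd] frc grc fg t t0; apply/eqP; rewrite -subr_eq0 -normr_eq0.
apply/negPn/negP => nz; have e0 : 0 < `|f t - g t| by rewrite lt_neqAle eq_sym nz/=.
have e2 : 0 < `|f t - g t| / 2 by rewrite divr_gt0.
have /cvgrPdist_lt/(_ _ e2) [d1 /= d10 fd] := frc t t0.
have /cvgrPdist_lt/(_ _ e2) [d2 /= d20 gd] := grc t t0.
pose d := Num.min d1 d2.
have d0 : 0 < d by rewrite lt_min d10.
have m0 : 0 <= t + d / 2 by rewrite addr_ge0// divr_ge0// ltW.
have [s [Ds /=]] := Dd _ m0 _ (nbhsx_ballx _ _ (divr_gt0 d0 (ltr0Sn R 1))).
rewrite /ball/= ltr_distl => /andP[s1 s2].
have ts : t < s by lra.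
have std : `|t - s| < d by rewrite distrC gtr0_norm; lra.
have := fd s _ ts; have := gd s _ ts; rewrite /= (fg s Ds).
move: std; rewrite /d lt_min => /andP[st1 st2].
move=> /(_ st2) h2 /(_ st1) h1.
have := ler_distD (g s) (f t) (g t); rewrite (distrC (g s)); lra.
Qed.

(** * The weak law of large numbers *)

Lemma indic_le (T : Type) (R : realType) (A : set T) (f : T -> R) (k : R) x :
  0 <= f x -> (A x -> k <= f x) -> k * \1_A x <= f x.
Proof.
move=> f0 kf; rewrite indicE; have [/set_mem/kf|_] := boolP (x \in A).
  by rewrite mulr1.
by rewrite mulr0.
Qed.

Section WeakLLN.
Context (d : measure_display) (T : measurableType d) (R : realType).
Context (Q : probability T R) (A : nat -> set T) (p : R).
Hypothesis mA : forall i, measurable (A i).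
Hypothesis QA : forall i, Q (A i) = p%:E.
Hypothesis QAA : forall i j, i <> j -> Q (A i `&` A j) = (p * p)%:E.

Let count n x : R := \sum_(i < n) \1_(A i) x.

Let measurable_count n : measurable_fun setT (count n).
Proof. by apply: measurable_sum => i; exact: measurable_indic. Qed.

Let p01 : 0 <= p <= 1.
Proof. by rewrite -!lee_fin -(QA 0) measure_ge0/= probability_le1. Qed.

Let count_ge0 n x : 0 <= count n x.
Proof. by apply: sumr_ge0 => i _; rewrite indicE. Qed.

Let integral_level i : (\int[Q]_x (\1_(A i) x : R)%:E = p%:E)%E.
Proof. by rewrite integral_indic// setIT; exact: QA. Qed.

Let integral_level2 i j : i <> j ->
  (\int[Q]_x (\1_(A i `&` A j) x : R)%:E = (p * p)%:E)%E.
Proof.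
move=> ij; rewrite integral_indic//; first by rewrite setIT; exact: QAA.
exact: measurableI.
Qed.

Let integral_count n : (\int[Q]_x (count n x)%:E = (n%:R * p)%:E)%E.
Proof.
rewrite /count; under eq_integral do rewrite -sumEFin.
rewrite ge0_integral_sum//.
  under eq_bigr do rewrite integral_level.
  by rewrite sumEFin sumr_const card_ord mulr_natl.
by move=> i; apply/measurable_EFinP; exact: measurable_indic.
Qed.

Let integral_count_sqr n :
  (\int[Q]_x (count n x * count n x)%:E =
   (n%:R * p + (n%:R * n%:R - n%:R) * (p * p))%:E)%E.
Proof.
transitivity (\int[Q]_x (\sum_(i < n) \sum_(j < n) (\1_(A i `&` A j) x : R)%:E))%E.
  apply: eq_integral => x _; rewrite /count mulr_suml -sumEFin.
  apply: eq_bigr => i _; rewrite mulr_sumr -sumEFin.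
  by apply: eq_bigr => j _; rewrite indicI.
have mAA i j : measurable_fun setT (fun x => (\1_(A i `&` A j) x : R)%:E).
  by apply/measurable_EFinP; apply: measurable_indic; exact: measurableI.
rewrite ge0_integral_sum//; first last.
- by move=> i x _; apply: sume_ge0 => j _; rewrite lee_fin.
- by move=> i; apply: emeasurable_sum.
transitivity (\sum_(i < n) (p + (n%:R - 1) * (p * p))%:E)%E.
  apply: eq_bigr => i _; rewrite ge0_integral_sum//.
  rewrite (bigD1 i)//= setIid integral_level.
  under eq_bigr => j ji do
    (rewrite integral_level2; last by move=> /ord_inj ij; rewrite ij eqxx in ji).
  rewrite sumEFin sumr_const cardC1 card_ord -EFinD; congr (_ + _)%:E.
  rewrite -[LHS]mulr_natl; congr (_ * _); case: n i => [[]//|n] _.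
  by rewrite -natr1 addrK.
rewrite sumEFin sumr_const card_ord; congr EFin.
by rewrite -[LHS]mulr_natl; ring.
Qed.

(** Chebyshev's inequality: pairwise independence gives the count the variance
    [n p (1 - p) <= n], hence the bound [1 / (n e^2)]. *)
Theorem weak_lln (e : R) : 0 < e ->
  Q [set x | e <= `|(\sum_(i < n) \1_(A i) x) / n%:R - p|] @[n --> \oo] --> 0%E.
Proof.
move=> e0; have /andP[p0 p1] := p01.
pose B n := [set x | e <= `|count n x / n%:R - p|].
have mB n : measurable (B n).
  have m : measurable_fun setT (fun x => `|count n x / n%:R - p|).
    apply: measurableT_comp => //; apply: measurable_funB; last exact: measurable_cst.
    by apply: measurable_funM => //; exact: measurable_cst.
  rewrite (_ : B n = setT `&` (fun x => `|count n x / n%:R - p|) @^-1` `[e, +oo[%classic).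
    by apply: m => //; exact: measurable_itv.
  by apply/seteqP; split => x /=; rewrite in_itv/= andbT // => -[].
have bound n : (0 < n)%N -> (Q (B n) <= (n%:R^-1 * (e * e)^-1)%:E)%E.
  move=> n0; have nR : 0 < n%:R :> R by rewrite ltr0n.
  have np0 : 0 <= n%:R * p by rewrite mulr_ge0// ltW.
  have dev := integral_sqr_deviation (measurable_count n) (count_ge0 n) np0
    (integral_count n) (integral_count_sqr n).
  have k0 : 0 < (n%:R * e) * (n%:R * e) by rewrite !mulr_gt0.
  have mD : measurable_fun setT
      (fun x => (count n x - n%:R * p) * (count n x - n%:R * p)).
    by apply: measurable_funM; apply: measurable_funB => //; exact: measurable_cst.
  have : (((n%:R * e) * (n%:R * e))%:E * Q (B n) <= n%:R%:E)%E.
    apply: (@le_trans _ _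
        (\int[Q]_x ((count n x - n%:R * p) * (count n x - n%:R * p))%:E)%E).
      have := integral_indic Q measurableT (mB n); rewrite setIT => <-.
      rewrite -ge0_integralZl_EFin//; last 2 first.
      - by apply/measurable_EFinP; exact: measurable_indic.
      - exact: ltW.
      apply: ge0_le_integral => //.
      - by move=> x _; rewrite lee_fin mulr_ge0// ltW.
      - apply/measurable_EFinP; apply: measurable_funM; first exact: measurable_cst.
        exact: measurable_indic.
      - exact/measurable_EFinP.
      - move=> x _; rewrite lee_fin; apply: (@indic_le _ _ _
          (fun x => (count n x - n%:R * p) * (count n x - n%:R * p))).
          by rewrite -expr2 sqr_ge0.
        rewrite /B/= => eB; rewrite -!expr2 -[leRHS]real_normK ?num_real//.
        rewrite ler_pXn2r ?nnegrE ?(ltW (mulr_gt0 nR e0))//.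
        have -> : count n x - n%:R * p = n%:R * (count n x / n%:R - p).
          by rewrite mulrBr mulrCA divff ?gt_eqF// mulr1.
        by rewrite normrM gtr0_norm// ler_pM2l.
    rewrite dev lee_fin.
    have -> : n%:R * p + (n%:R * n%:R - n%:R) * (p * p) - n%:R * p * (n%:R * p) =
       n%:R * (p * (1 - p)) :> R by ring.
    by rewrite ler_piMr ?mulr_ile1//; lra.
  rewrite -(fineK (fin_num_measure Q _ (mB n))) -EFinM !lee_fin.
  rewrite -ler_pdivlMl// => /le_trans; apply.
  rewrite (_ : _ * n%:R = n%:R^-1 * (e * e)^-1)//.
  by field; rewrite !gt_eqF.
(* The bound holds for positive [n] only. *)
rewrite -[X in X @ _ --> _]/(fun n => Q (B n)) -cvg_shiftS.
have ub0 : (fun n => (n.+1%:R^-1 * (e * e)^-1)%:E) @ \oo --> (0 : R)%:E.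
  apply: cvg_EFin; first exact: nearW.
  rewrite -[X in _ --> X](mul0r (e * e)^-1).
  by apply: cvgM; [exact: cvg_harmonic|exact: cvg_cst].
apply: squeeze_cvge ub0; last exact: cvg_cst.
by apply: nearW => n; rewrite measure_ge0/= bound.
Qed.

End WeakLLN.

(** * Games with finitely many players *)

Section FiniteGame.
Context (R : realType) (Omega : Type) (r c : R).
Context (Y : nat -> R -> Omega -> R) (n : nat).
Context (tau : 'I_n -> Omega -> \bar R).
Hypothesis hc : 0 < c.
Hypothesis Ynd : forall i w, nondecreasing_in_time (fun t => Y i t w).
Hypothesis Yrc : forall i w, right_continuous_in_time (fun t => Y i t w).
Hypothesis tauE : forall i w,
  tau i w = hitting_time r (n_player_intensity c Y tau i) w.

Definition empirical_tail (y : R) (t : R) (w : Omega) : R :=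
  #|[pred j : 'I_n | y <= Y j t w]|%:R / n%:R.

Lemma stopped_fraction_others_nondecreasing i w :
  nondecreasing_in_time (fun t => stopped_fraction_others tau i t w).
Proof.
move=> s t _ st; rewrite ler_wpM2r ?invr_ge0// ler_nat.
apply: subset_leq_card; apply/fintype.subsetP => j; rewrite !inE => /andP[->/=].
by move=> /le_trans; apply; rewrite lee_fin.
Qed.

(** Each of the finitely many indicators of [tau^j <= s] is constant for [s] just
    after [t], including the case [tau^j = +oo]. *)
Lemma stopped_fraction_others_right_continuous i w :
  right_continuous_in_time (fun t => stopped_fraction_others tau i t w).
Proof.
move=> t t0; apply: cvg_near_cst.
have near_eq (j : 'I_n) : \forall s \near t^'+,
    (tau j w <= s%:E)%E = (tau j w <= t%:E)%E.
  have [jt|] := leP (tau j w) t%:E.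
    near=> s; apply: (le_trans jt); rewrite lee_fin; apply: ltW.
    by near: s; exact: nbhs_right_gt.
  case: (tau j w) => [u| |]//.
  - rewrite lte_fin => tu; near=> s; apply/negbTE; rewrite -ltNge lte_fin.
    by near: s; exact: nbhs_right_lt.
  - by move=> _; near=> s; rewrite leye_eq.
near=> s.
have sE : forall j, (tau j w <= s%:E)%E = (tau j w <= t%:E)%E.
  by near: s; exact: filter_forall.
rewrite /stopped_fraction_others; congr (_%:R / _).
by apply: eq_card => j; rewrite !inE sE.
Unshelve. all: end_near. Qed.

Lemma n_player_hitting_time_le i w t : 0 <= t ->
  (tau i w <= t%:E)%E = (r - c * stopped_fraction_others tau i t w <= Y i t w).
Proof.
move=> t0; rewrite tauE hitting_time_le//; first by rewrite lerBlDr.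
- apply: nondecreasing_intensity (ltW hc) _ _; first exact: Ynd.
  exact: stopped_fraction_others_nondecreasing.
- apply: right_continuous_intensity; first exact: Yrc.
  exact: stopped_fraction_others_right_continuous.
Qed.

Lemma stopped_fraction_othersE i t w :
  stopped_fraction tau t w =
  stopped_fraction_others tau i t w + ((tau i w <= t%:E)%E)%:R / n%:R.
Proof.
rewrite /stopped_fraction /stopped_fraction_others (cardD1 i) inE -mulrDl -natrD.
by rewrite addnC.
Qed.

Lemma stopped_fraction01 t w : 0 <= stopped_fraction tau t w <= 1.
Proof.
rewrite /stopped_fraction mulr_ge0 ?invr_ge0//=.
have [n0|n0] := posnP n.
  by have -> : n%:R = 0 :> R; [rewrite n0|rewrite invr0 mulr0].
rewrite ler_pdivrMr ?ltr0n// mul1r ler_nat.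
by apply: leq_trans (max_card _) _; rewrite card_ord.
Qed.

(** A player who has stopped faces a fraction of other stopped players at most the
    total fraction. *)
Lemma stopped_fraction_le_tail t w : 0 <= t ->
  stopped_fraction tau t w <= empirical_tail (r - c * stopped_fraction tau t w) t w.
Proof.
move=> t0; rewrite [leLHS]/stopped_fraction ler_wpM2r ?invr_ge0// ler_nat.
apply: subset_leq_card; apply/fintype.subsetP => j; rewrite !inE.
rewrite n_player_hitting_time_le//; apply: le_trans.
by rewrite lerB// ler_pM2l// (stopped_fraction_othersE j) lerDl divr_ge0.
Qed.

(** The fraction of other stopped players is at least the total fraction minus
    [1 / n]. *)
Lemma tail_le_stopped_fraction t w : 0 <= t ->
  empirical_tail (r - c * stopped_fraction tau t w + c / n%:R) t w <=
  stopped_fraction tau t w.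
Proof.
move=> t0; rewrite [leRHS]/stopped_fraction ler_wpM2r ?invr_ge0// ler_nat.
apply: subset_leq_card; apply/fintype.subsetP => j; rewrite !inE.
rewrite n_player_hitting_time_le//; apply: le_trans.
have : c * (((tau j w <= t%:E)%E)%:R / n%:R) <= c / n%:R.
  by rewrite ler_pM2l// ler_piMl ?invr_ge0//; case: (_ <= _)%E.
by rewrite (stopped_fraction_othersE j) mulrDr; lra.
Qed.

Lemma empirical_tail_nonincreasing y z t w : y <= z ->
  empirical_tail z t w <= empirical_tail y t w.
Proof.
move=> yz; rewrite ler_wpM2r ?invr_ge0// ler_nat.
apply: subset_leq_card; apply/fintype.subsetP => j; rewrite !inE.
exact: le_trans.
Qed.

End FiniteGame.

(** Otherwise the complements relative to [K] of the sets in the ideal [J] form a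
    proper filter on [K]; its cluster point has a neighbourhood in [J], a
    contradiction. *)
Lemma compact_in_ideal (T : topologicalType) (K : set T) (J : set T -> Prop) :
  (forall A B, J A -> J B -> J (A `|` B)) ->
  (forall A B, A `<=` B -> J B -> J A) -> J set0 ->
  compact K -> (forall x, K x -> exists2 U, nbhs x U & J U) -> J K.
Proof.
move=> JU JS J0 cK Kloc; apply: contrapT => nJK.
pose Fl : set_system T := [set A | J (K `\` A)].
have FF : ProperFilter Fl.
  split; first by rewrite /Fl/= setD0.
  split.
  - by rewrite /Fl/= setDT.
  - by move=> A B FA FB; rewrite /Fl/= setDIr; exact: JU.
  - by move=> A B AB; apply: JS; exact: setDS.
have FK : Fl K by rewrite /Fl/= setDv.
have [x [Kx clx]] := cK Fl FF FK.
have [U xU JU'] := Kloc x Kx.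
have FCU : Fl (~` U) by apply: JS JU' => y [_ /= /contrapT].
by have [y []] := clx _ _ FCU xU.
Qed.
Section VanishingEvents.
Context (R : realType) (dO : measure_display) (Omega : measurableType dO).
Context (P : probability Omega R) (X : nat -> Omega -> R).

(** The probability that [X n] lies in [A] tends to zero.  The events [B n] stand
    in for the possibly nonmeasurable events [X n \in A], so that the sets avoided
    form an ideal without any condition on [A] or [X]. *)
Definition asymptotically_avoids (A : set R) : Prop :=
  exists B : nat -> set Omega, [/\ (forall n, measurable (B n)),
    (\forall n \near \oo, forall w, A (X n w) -> B n w) &
    P (B n) @[n --> \oo] --> 0%E].

Lemma asymptotically_avoidsU A B :
  asymptotically_avoids A -> asymptotically_avoids B ->
  asymptotically_avoids (A `|` B).
Proof.
move=> [C [mC AC C0]] [D [mD BD D0]]; exists (fun n => C n `|` D n); split.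
- by move=> n; exact: measurableU.
- by apply: filterS2 AC BD => n AC BD w [/AC|/BD]; [left|right].
- have CD0 : (P (C n) + P (D n))%E @[n --> \oo] --> 0%E.
    by rewrite -[X in _ --> X](adde0 0%E); apply: cvgeD.
  apply: squeeze_cvge CD0; last exact: cvg_cst.
  by apply: nearW => n; rewrite measure_ge0/=; exact: measureU2.
Qed.

Lemma asymptotically_avoidsS A B : A `<=` B ->
  asymptotically_avoids B -> asymptotically_avoids A.
Proof.
move=> AB [C [mC BC C0]]; exists C; split => //.
by apply: filterS BC => n BC w /AB /BC.
Qed.

Lemma asymptotically_avoids0 : asymptotically_avoids set0.
Proof.
exists (fun=> set0); split => //; first exact: nearW.
by rewrite measure0; exact: cvg_cst.
Qed.

Lemma asymptotically_avoids_cvg A (B : nat -> set Omega) :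
  asymptotically_avoids A ->
  (\forall n \near \oo, measurable (B n) /\ forall w, B n w -> A (X n w)) ->
  P (B n) @[n --> \oo] --> 0%E.
Proof.
move=> [C [mC AC C0]] BA; apply: squeeze_cvge C0; last exact: cvg_cst.
apply: filterS2 AC BA => n AC [mB BA]; rewrite measure_ge0/=.
by apply: le_measure; rewrite ?inE// => w /BA /AC.
Qed.

End VanishingEvents.

Section FiniteGameLimit.
Context (R : realType) (dO : measure_display) (Omega : measurableType dO).
Context (P : probability Omega R) (G : R -> set (set Omega)).
Context (r c : R) (F : R -> R -> R) (Y : nat -> R -> Omega -> R).
Context (tau : forall n, 'I_n -> Omega -> \bar R).
Context (rho_ : nat -> R -> Omega -> R).
Hypothesis hG : right_continuous_filtration G.
Hypothesis hc : 0 < c.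
Hypothesis hF : forall t, 0 <= t -> continuous (F t).
Hypothesis hY : n_player_signals P G F Y.
Hypothesis heq : forall n, (0 < n)%N ->
  n_player_equilibrium G r c Y (@tau n) (rho_ n).

Let Ynd i w : nondecreasing_in_time (fun t => Y i t w).
Proof. by case: hY => /(_ i)[_ Yi _ _] _ _; exact: Yi. Qed.

Let Yrc i w : right_continuous_in_time (fun t => Y i t w).
Proof. by case: hY => /(_ i)[_ _ Yi _] _ _; exact: Yi. Qed.

Let fraction_bounds n t w : (0 < n)%N -> 0 <= t ->
  [/\ 0 <= rho_ n t w <= 1,
      rho_ n t w <= empirical_tail Y n (r - c * rho_ n t w) t w &
      empirical_tail Y n (r - c * rho_ n t w + c / n%:R) t w <= rho_ n t w].
Proof.
move=> n0 t0; have [_ rhoE _ tauE] := heq n0; rewrite rhoE//; split.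
- exact: stopped_fraction01.
- exact: stopped_fraction_le_tail.
- exact: tail_le_stopped_fraction.
Qed.

Definition tail_deviates (t y e : R) (n : nat) : set Omega :=
  [set w | e <= `|empirical_tail Y n y t w - (1 - F t y)|].

Lemma tail_deviates_vanishes t y e : 0 <= t -> 0 < e ->
  (forall n, measurable (tail_deviates t y e n)) /\
  P (tail_deviates t y e n) @[n --> \oo] --> 0%E.
Proof.
move=> t0 e0; case: hY => sY indY cY.
have mY i : measurable_fun setT (Y i t) by exact: signal_measurable (sY i) t0.
pose A i := [set w | y <= Y i t w].
have mA i : measurable (A i) by exact: measurable_ge.
have PA i : P (A i) = (1 - F t y)%:E by exact: probability_ge (cY t i t0) (hF t0).
have PAA i j : i <> j -> P (A i `&` A j) = ((1 - F t y) * (1 - F t y))%:E.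
  move=> ij; have := indY t i j t0 ij _ _
    (measurable_itv `[y, +oo[) (measurable_itv `[y, +oo[).
  have pre k : Y k t @^-1` `[y, +oo[%classic = A k.
    by apply/seteqP; split => w /=; rewrite in_itv/= andbT.
  by rewrite !pre !PA -EFinM.
have tailE n w : empirical_tail Y n y t w = (\sum_(i < n) \1_(A i) w) / n%:R.
  rewrite /empirical_tail -sum1_card big_mkcond natr_sum; congr (_ / _).
  apply: eq_bigr => i _; rewrite indicE inE.
  rewrite (_ : (w \in A i) = (y <= Y i t w)) ?inE; first by case: ifP.
  by apply/idP/idP; rewrite inE.
have devE n : tail_deviates t y e n =
    [set w | e <= `|(\sum_(i < n) \1_(A i) w) / n%:R - (1 - F t y)|].
  by apply/seteqP; split => w; rewrite /tail_deviates/= tailE.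
split.
  move=> n; rewrite devE.
  have m : measurable_fun setT
      (fun w => `|(\sum_(i < n) \1_(A i) w) / n%:R - (1 - F t y)|).
    apply: measurableT_comp => //; apply: measurable_funB => //.
    apply: measurable_funM => //.
    by apply: measurable_sum => i; exact: measurable_indic.
  exact: measurable_ge m.
under eq_fun do rewrite devE.
exact: weak_lln.
Qed.

(** Say [1 < phi t v].  If the fraction [u] is within [del] of [v], then
    [v - del < u] is below the empirical tail at the level
    [y = r - c * v - c * del], whereas the limit [1 - F t y] of that tail is less
    than [v] by almost [eta]: the tail at the fixed level [y] deviates from its
    limit by at least [eta / 2].  The case [phi t v < 1] is symmetric, with a
    second margin [c * del] to absorb [c / n]. *)
Lemma avoids_near_nonsolution t v : 0 <= t -> v + F t (r - c * v) != 1 ->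
  exists2 U, nbhs v U & asymptotically_avoids P (fun n => rho_ n t) U.
Proof.
move=> t0 vN1.
pose eta := `|v + F t (r - c * v) - 1|.
have eta0 : 0 < eta by rewrite normr_gt0 subr_eq0.
have e4 : 0 < eta / 4 by rewrite divr_gt0.
have e2 : 0 < eta / 2 by rewrite divr_gt0.
have Fc : continuous (F t) by exact: hF.
have /cvgrPdist_lt /(_ _ e4) [d /= d0 Fd] := Fc (r - c * v).
(* The factor 4 keeps the levels at distance [c * del] and [2 * c * del] from
   [r - c * v] within the modulus of continuity [d]. *)
pose del := Num.min (eta / 4) (d / (4 * c)).
have c4 : 0 < 4 * c by rewrite mulr_gt0.
have del0 : 0 < del by rewrite lt_min e4/= divr_gt0.
have dele : del <= eta / 4 by rewrite ge_min lexx.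
have deld : c * del <= d / 4.
  have : del <= d / (4 * c) by rewrite ge_min lexx orbT.
  rewrite ler_pdivlMr// => h; rewrite ler_pdivlMr//.
  by rewrite (_ : c * del * 4 = del * (4 * c))//; ring.
have cdel0 : 0 < c * del by rewrite mulr_gt0.
exists (ball v del); first exact: nbhsx_ballx.
have [vgt|vlt|veq] := ltgtP 1 (v + F t (r - c * v)); last by rewrite veq eqxx in vN1.
- have etaE : eta = v + F t (r - c * v) - 1 by rewrite /eta gtr0_norm// subr_gt0.
  pose y := r - c * v - c * del.
  have Fy : `|F t (r - c * v) - F t y| < eta / 4.
    by apply: Fd => /=; rewrite /y opprB addrC subrK gtr0_norm//; lra.
  have [mB B0] := tail_deviates_vanishes y t0 e2.
  exists (tail_deviates t y (eta / 2)); split => //.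
  near=> n => w; rewrite /ball/= ltr_distlC => /andP[u1 u2].
  have n0 : (0 < n)%N by near: n; exact: nbhs_infty_gt.
  have [_ uG _] := fraction_bounds w n0 t0.
  have yu : y <= r - c * rho_ n t w.
    by rewrite /y; have := ltW u2; rewrite -(ler_pM2l hc) mulrDr; lra.
  have := empirical_tail_nonincreasing Y n t w yu.
  move: Fy; rewrite /tail_deviates/= ltr_norml => /andP[Fy1 Fy2] Gy.
  by apply: le_trans (ler_norm _); lra.
- have etaE : eta = 1 - (v + F t (r - c * v)) by rewrite /eta ltr0_norm ?subr_lt0// opprB.
  pose y := r - c * v + c * del + c * del.
  have Fy : `|F t (r - c * v) - F t y| < eta / 4.
    apply: Fd => /=; rewrite /y (_ : _ - _ = - (c * del + c * del)); last by ring.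
    by rewrite normrN gtr0_norm//; lra.
  have [mB B0] := tail_deviates_vanishes y t0 e2.
  exists (tail_deviates t y (eta / 2)); split => //.
  near=> n => w; rewrite /ball/= ltr_distlC => /andP[u1 u2].
  have n0 : (0 < n)%N by near: n; exact: nbhs_infty_gt.
  have [_ _ uG] := fraction_bounds w n0 t0.
  have ndel : n%:R^-1 <= del.
    rewrite -[leRHS]invrK lef_pV2 ?posrE ?invr_gt0 ?ltr0n//.
    by near: n; exact: nbhs_infty_ger.
  have yu : r - c * rho_ n t w + c / n%:R <= y.
    have h1 : c / n%:R <= c * del by rewrite ler_pM2l.
    by rewrite /y; have := ltW u1; rewrite -(ler_pM2l hc) mulrBr; lra.
  have := empirical_tail_nonincreasing Y n t w yu.
  move: Fy; rewrite /tail_deviates/= ltr_norml => /andP[Fy1 Fy2] Gy.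
  by rewrite -normrN; apply: le_trans (ler_norm _); lra.
Unshelve. all: end_near. Qed.

Theorem finite_game_cvg t u : 0 <= t -> solution F r c t u ->
  (forall v, solution F r c t v -> v = u) ->
  forall e, 0 < e -> P [set w | e <= `|rho_ n t w - u|] @[n --> \oo] --> 0%E.
Proof.
move=> t0 usol uniq_u e e0.
pose K := `[0, 1]%classic `&` [set v | e <= `|v - u|].
have cK : compact K.
  apply: compact_closedI; first exact: segment_compact.
  rewrite (_ : mkset _ = (fun v => `|v - u|) @^-1` [set x | e <= x]) //.
  apply: preimage_closed; last exact: closed_ge.
  by move=> v _; apply: cvg_norm; apply: cvgB; [exact: cvg_id|exact: cvg_cst].
have avK : asymptotically_avoids P (fun n => rho_ n t) K.
  apply: (compact_in_ideal _ _ _ cK).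
  - exact: asymptotically_avoidsU.
  - exact: asymptotically_avoidsS.
  - exact: asymptotically_avoids0.
  - move=> v [v01 ve]; apply: avoids_near_nonsolution => //.
    apply/eqP => veq; have vu : v = u.
      by apply: uniq_u; split=> //; move: v01; rewrite /= in_itv.
    by move: ve; rewrite /= vu subrr normr0 leNgt e0.
apply: asymptotically_avoids_cvg avK _.
near=> n; have n0 : (0 < n)%N by near: n; exact: nbhs_infty_gt.
split.
  have [arho _ _ _] := heq n0.
  have mrho := adapted_measurable hG arho t0.
  apply: (@measurable_ge _ _ _ (fun w => `|rho_ n t w - u|)).
  apply: measurableT_comp => //; apply: measurable_funB => //; exact: measurable_cst.
move=> w we; split => //=.
by have [] := fraction_bounds w n0 t0; rewrite in_itv.
Unshelve. all: end_near. Qed.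

End FiniteGameLimit.

(** * Uniqueness of the equilibrium and of the solutions *)

Section Corollary.
Context (R : realType) (dI dO : measure_display).
Context (I : measurableType dI) (Omega : measurableType dO).
Context (lambda : probability I R) (P : probability Omega R).
Context (Sigma : set (set (I * Omega))).
Context (mu : probability (g_sigma_algebraType Sigma) R).
Context (G : R -> set (set Omega)) (r c : R) (F : R -> R -> R).
Context (Y : I -> R -> Omega -> R).
Hypothesis hG : right_continuous_filtration G.
Hypothesis hc : 0 < c.
Hypothesis Ffam : cdf_family F.
Hypothesis hmu : fubini_extension lambda P mu.
Hypothesis hY : mean_field_signals lambda P Sigma G F Y.

Let hF t : 0 <= t -> continuous (F t).
Proof. by case: Ffam => Fc _ _ _ _; exact: Fc. Qed.

Lemma right_limit_equilibrium (rho : R -> R) :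
  nondecreasing_in_time rho -> (forall t, 0 <= t -> solution F r c t (rho t)) ->
  mean_field_equilibrium lambda P r c Y (right_limit rho).
Proof.
move=> rnd rsol; apply: solution_mean_field_equilibrium hG hc hF hmu hY _ _ _ _.
- exact: right_limit_nondecreasing.
- exact: right_limit_right_continuous.
- exact: right_limit_solution.
Qed.

(** With [m] and [M] the least and the greatest solution, the equilibria given by
    their right limits coincide, so that at a time where [m] equals its right
    limit, [M s <= right_limit M s = right_limit m s = m s]. *)
Lemma unique_solution_of_unique_equilibrium (rho : R -> R) :
  unique_mean_field_equilibrium lambda P r c Y rho ->
  dense_in_nonneg [set t | 0 <= t /\ exists! u, solution F r c t u].
Proof.
move=> [_ rho_uniq]; split; first by move=> t [].
move=> t t0 B [e /= e0 Be].
have [m [mnd mP]] := least_solution r c Ffam.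
have [M [Mnd MP]] := greatest_solution r c Ffam.
have mrho := rho_uniq _ (right_limit_equilibrium mnd (fun t t0 => (mP t t0).1)).
have Mrho := rho_uniq _ (right_limit_equilibrium Mnd (fun t t0 => (MP t t0).1)).
have te : t < t + e by rewrite ltrDl.
have [s [/andP[ts se] ms]] := right_limit_eq_somewhere mnd t0 te.
have s0 : 0 <= s by rewrite (le_trans t0)// ltW.
exists s; split; last first.
  by apply: Be; rewrite /= distrC gtr0_norm ?subr_gt0// ltrBlDl.
split => //; exists (m s); split; first exact: (mP s s0).1.
move=> v sv; apply/eqP; rewrite eq_le (mP s s0).2//=.
apply: le_trans ((MP s s0).2 v sv) _.
by rewrite (le_trans (right_limit_ge Mnd s0))// Mrho// -mrho// ms.
Qed.

Lemma unique_equilibrium_of_unique_solution :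
  dense_in_nonneg [set t | 0 <= t /\ exists! u, solution F r c t u] ->
  exists rho, unique_mean_field_equilibrium lambda P r c Y rho.
Proof.
move=> dense; have [m [mnd mP]] := least_solution r c Ffam.
have meq := right_limit_equilibrium mnd (fun t t0 => (mP t t0).1).
exists (right_limit m); split => // rho' req.
have [_ mrc msol] := mean_field_equilibrium_solution hG hc hF hmu hY meq.
have [_ rrc rsol] := mean_field_equilibrium_solution hG hc hF hmu hY req.
apply: (right_continuous_eq dense rrc mrc) => t [t0 [u [_ uu]]].
by rewrite -(uu _ (rsol t t0)) -(uu _ (msol t t0)).
Qed.

End Corollary.

Theorem corollary5p5 (R : realType) (dI dO : measure_display)
    (I : measurableType dI) (Omega : measurableType dO)
    (lambda : probability I R) (P : probability Omega R)
    (Sigma : set (set (I * Omega)))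
    (mu : probability (g_sigma_algebraType Sigma) R)
    (G : R -> set (set Omega)) (r c : R) (F : R -> R -> R)
    (Y : nat -> R -> Omega -> R) (Ymf : I -> R -> Omega -> R)
    (E : {RV P >-> R})
    (hG : right_continuous_filtration G)
    (hc : 0 < c)
    (hF : forall t, 0 <= t -> continuous (F t))
    (hY : n_player_signals P G F Y)
    (hlambda : atomless lambda)
    (hmu : fubini_extension lambda P mu)
    (hYmf : mean_field_signals lambda P Sigma G F Ymf)
    (hE : forall A : set R, measurable A ->
       distribution P E A = exponential_prob 1 A)
    (hEG : independent_of_filtration P G E)
    (hmf : forall rho, mean_field_equilibrium lambda P r c Ymf rho ->
       \forall i \ae lambda,
         standing_assumption P G r E (mean_field_intensity c Ymf rho i)) :
  ((exists rho, unique_mean_field_equilibrium lambda P r c Ymf rho) <->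
   dense_in_nonneg [set t | 0 <= t /\
     exists! u, 0 <= u <= 1 /\ u + F t (r - c * u) = 1]) /\
  (forall rho, unique_mean_field_equilibrium lambda P r c Ymf rho ->
   forall (rho_ : nat -> R -> Omega -> R)
          (tau : forall n, 'I_n -> Omega -> \bar R),
     (forall n, (0 < n)%N ->
        n_player_equilibrium G r c Y (tau n) (rho_ n)) ->
     (forall n (i : 'I_n),
        standing_assumption P G r E (n_player_intensity c Y (tau n) i)) ->
     fatou_cvg_in_probability P rho_ rho).
Proof.
have Ffam : cdf_family F.
  case: hY => sY _ cY.
  exact: (signal_cdf_family hG (sY 0%N) (fun t => cY t 0%N) hF).
split; first split.
- by move=> [rho] /(unique_solution_of_unique_equilibrium hG hc Ffam hmu hYmf).
- exact: (unique_equilibrium_of_unique_solution hG hc Ffam hmu hYmf).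
move=> rho rho_uniq rho_ tau heq _.
exists [set t | 0 <= t /\ exists! u, solution F r c t u]; split.
  exact: (unique_solution_of_unique_equilibrium hG hc Ffam hmu hYmf rho_uniq).
move=> t [t0 [u [usol uu]]].
have [_ _ rsol] := mean_field_equilibrium_solution hG hc hF hmu hYmf rho_uniq.1.
apply: (finite_game_cvg hG hc hF hY heq t0 (rsol t t0)) => v /uu <-.
exact: (uu _ (rsol t t0)).
Qed.
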